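(* Let $p$ be a prime and let $\mathbf F$ be a non-abelian free pro-$p$ group of finite rank. Then $\mathrm{Comm}(\mathbf F)=\mathrm{AComm}(\mathbf F)$, that is, $\mathrm{Comm}(\mathbf F)$ is generated by subgroups of the form $\mathrm{Aut}(\mathbf U)$ where $\mathbf U$ is open in $\mathbf F$.
   Context: For a profinite group $G$, $\mathrm{Comm}(G)$ is the group of equivalence classes $[f]$ of topological group isomorphisms $f:U\to V$ between open subgroups of $G$, where two such isomorphisms are equivalent if they coincide on some open subgroup of $G$, with product $[f_1][f_2]=[f_1\circ f_2]$ (for $f_i:U_i\to V_i$, the composition is defined on $f_2^{-1}(V_2\cap U_1)$). For an open subgroup $\mathbf U$ of $\mathbf F$, $\mathrm{Aut}(\mathbf U)$ denotes the group of topological automorphisms of $\mathbf U$; the canonical homomorphism $\mathrm{Aut}(\mathbf U)\to\mathrm{Comm}(\mathbf F)$, $\phi\mapsto[\phi]$, is injective, and $\mathrm{Aut}(\mathbf U)$ is identified with its image. $\mathrm{AComm}(\mathbf F)$ is the subgroup of $\mathrm{Comm}(\mathbf F)$ generated by all $\mathrm{Aut}(\mathbf U)$ with $\mathbf U$ open in $\mathbf F$. *)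

(* Defs.v *)
From HB Require Import structures.
From mathcomp Require Import all_boot.
From mathcomp Require Import boolp classical_sets functions cardinality.
From mathcomp Require Import topology.

Set Implicit Arguments.
Unset Strict Implicit.
Unset Printing Implicit Defensive.

Local Open Scope classical_set_scope.
Local Open Scope card_scope.
Local Open Scope quotient_scope.
Local Open Scope group_scope.

HB.mixin Record isTopologicalGroup G of Group G & Topological G := {
  mulg_continuous : continuous (fun x : G * G => x.1 * x.2);
  invg_continuous : continuous (fun x : G => x^-1)
}.

#[short(type="topGroupType")]
HB.structure Definition TopologicalGroup :=
  {G of Group G & Topological G & isTopologicalGroup G}.

Definition subgroup (G : groupType) (A : set G) : Prop :=
  [/\ A 1, forall x y, A x -> A y -> A (x * y) & forall x, A x -> A x^-1].

Definition normal_subgroup (G : groupType) (A : set G) : Prop :=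
  subgroup A /\ forall x y, A x -> A (x ^ y).

Definition generated_subgroup (G : groupType) (A : set G) : set G :=
  smallest (@subgroup G) A.

Definition left_cosets (G : groupType) (A : set G) : set (set G) :=
  range (fun x : G => [set x * a | a in A]).

Definition open_subgroup (G : topGroupType) (U : set G) : Prop :=
  open U /\ subgroup U.

Definition profinite (G : topGroupType) : Prop :=
  [/\ compact [set: G], hausdorff_space G & totally_disconnected [set: G]].

(* Every quotient by an open normal subgroup is a finite p-group: it has
   p ^ k elements for some k. *)
Definition pro_p (p : nat) (G : topGroupType) : Prop :=
  profinite G /\
  forall N : set G, open N -> normal_subgroup N ->
    exists k : nat, left_cosets N #= `I_(p ^ k)%N.

(* F is free pro-p of rank d: some family x of d elements of F satisfies the
   universal property among pro-p groups. *)
Definition free_pro_p (p d : nat) (F : topGroupType) : Prop :=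
  pro_p p F /\
  exists x : 'I_d -> F, forall P : topGroupType, pro_p p P ->
    forall y : 'I_d -> P, exists! f : F -> P,
      [/\ continuous f, {morph f : a b / a * b} & forall i, f (x i) = y i].

(* An isomorphism of topological groups between the open subgroups [vdom] and
   [vcod]. The functions [vfun] and [vinv] are total, but their values outside
   [vdom] and [vcod] are irrelevant. *)
Record virtual_iso (G : topGroupType) := VirtualIso {
  vdom : set G;
  vcod : set G;
  vfun : G -> G;
  vinv : G -> G;
  vdom_open : open_subgroup vdom;
  vcod_open : open_subgroup vcod;
  vfun_cod : set_fun vdom vcod vfun;
  vinv_dom : set_fun vcod vdom vinv;
  vfunK : forall x, vdom x -> vinv (vfun x) = x;
  vinvK : forall y, vcod y -> vfun (vinv y) = y;
  vfunM : forall x y, vdom x -> vdom y -> vfun (x * y) = vfun x * vfun y;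
  vfun_continuous : {within vdom, continuous vfun};
  vinv_continuous : {within vcod, continuous vinv}
}.

HB.instance Definition _ (G : topGroupType) := gen_eqMixin (virtual_iso G).
HB.instance Definition _ (G : topGroupType) := gen_choiceMixin (virtual_iso G).

Section Commensurator.
Variable G : topGroupType.
Implicit Types f g h : virtual_iso G.

Lemma open_subgroupT : open_subgroup [set: G].
Proof. by split; [exact: openT | split]. Qed.

Lemma open_subgroupI (U V : set G) :
  open_subgroup U -> open_subgroup V -> open_subgroup (U `&` V).
Proof.
move=> [oU [U1 UM UV]] [oV [V1 VM VV]]; split; first exact: openI.
split=> [//|x y [Ux Vx] [Uy Vy]|x [Ux Vx]].
- by split; [exact: UM | exact: VM].
- by split; [exact: UV | exact: VV].
Qed.

Lemma vfun1 f : vfun f 1 = 1.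
Proof.
have [_ [f1 _ _]] := vdom_open f.
by apply: (mulgI (vfun f 1)); rewrite -(vfunM f1 f1) !mulg1.
Qed.

Lemma vfunV f x : vdom f x -> vfun f x^-1 = (vfun f x)^-1.
Proof.
have [_ [_ _ fV]] := vdom_open f => fx.
by apply: (mulgI (vfun f x)); rewrite -(vfunM fx (fV _ fx)) !mulgV vfun1.
Qed.

Lemma vinvM f x y :
  vcod f x -> vcod f y -> vinv f (x * y) = vinv f x * vinv f y.
Proof.
move=> fx fy; have [_ [_ fM _]] := vdom_open f.
rewrite -{1}(vinvK fx) -{1}(vinvK fy).
by rewrite -(vfunM (vinv_dom fx) (vinv_dom fy)) vfunK//; apply: fM; exact: vinv_dom.
Qed.

Lemma open_subgroup_preimage f (W : set G) :
  open_subgroup W -> open_subgroup (vdom f `&` vfun f @^-1` W).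
Proof.
move=> [oW [W1 WM WV]]; have [od [f1 fM fV]] := vdom_open f; split.
  have := @vfun_continuous _ f; rewrite continuous_open_subspace//.
  by move=> /(continuous_inP _ od); apply.
split=> [|x y [fx Wx] [fy Wy]|x [fx Wx]].
- by split=> //=; rewrite vfun1.
- by split; [exact: fM | rewrite /= vfunM//; exact: WM].
- by split; [exact: fV | rewrite /= vfunV//; exact: WV].
Qed.

Definition virtual_id : virtual_iso G.
Proof.
refine (@VirtualIso G setT setT id id open_subgroupT open_subgroupT
  _ _ _ _ _ _ _) => //; by apply: continuous_subspaceT => x; exact: cvg_id.
Defined.

Definition virtual_inv f : virtual_iso G :=
  VirtualIso (vcod_open f) (vdom_open f) (@vinv_dom _ f) (@vfun_cod _ f)
    (@vinvK _ f) (@vfunK _ f) (@vinvM f)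
    (@vinv_continuous _ f) (@vfun_continuous _ f).

Lemma virtual_comp_continuous f g :
  {within vdom g `&` vfun g @^-1` vdom f, continuous (vfun f \o vfun g)}.
Proof.
have [of' _] := vdom_open f; have [og _] := vdom_open g.
have [oI _] := open_subgroup_preimage g (vdom_open f).
rewrite (continuous_open_subspace _ oI) => x /set_mem[gx fx].
apply: continuous_comp.
- have := @vfun_continuous _ g; rewrite (continuous_open_subspace _ og).
  by apply; exact: mem_set.
- have := @vfun_continuous _ f; rewrite (continuous_open_subspace _ of').
  by apply; exact: mem_set.
Qed.

(* f \o g, defined on the preimage under g of vcod g `&` vdom f. *)
Definition virtual_comp f g : virtual_iso G.
Proof.
refine (@VirtualIso G
  (vdom g `&` vfun g @^-1` vdom f) (vcod f `&` vinv f @^-1` vcod g)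
  (vfun f \o vfun g) (vinv g \o vinv f)
  (open_subgroup_preimage g (vdom_open f))
  (open_subgroup_preimage (virtual_inv f) (vcod_open g)) _ _ _ _ _
  (@virtual_comp_continuous f g)
  (@virtual_comp_continuous (virtual_inv g) (virtual_inv f))).
- move=> x [gx fx]; split; first exact: vfun_cod.
  by rewrite /= vfunK//; exact: vfun_cod.
- move=> y [fy gy]; split; first exact: vinv_dom.
  by rewrite /= vinvK//; exact: vinv_dom.
- by move=> x [gx fx] /=; rewrite !vfunK.
- by move=> y [fy gy] /=; rewrite !vinvK.
- by move=> x y [gx fx] [gy fy] /=; rewrite !vfunM.
Defined.

Definition virtual_equiv : rel (virtual_iso G) := fun f g =>
  `[< exists U : set G, [/\ open_subgroup U, U `<=` vdom f `&` vdom g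
                          & {in U, vfun f =1 vfun g}] >].

Lemma virtual_equiv_refl : reflexive virtual_equiv.
Proof.
by move=> f; apply/asboolP; exists (vdom f); split=> //; exact: vdom_open.
Qed.

Lemma virtual_equiv_sym : symmetric virtual_equiv.
Proof.
suff equivC f g : virtual_equiv f g -> virtual_equiv g f.
  by move=> f g; apply/idP/idP; exact: equivC.
move=> /asboolP[U [oU sU eU]]; apply/asboolP; exists U; split=> //.
- by rewrite setIC.
- by move=> x Ux; rewrite eU.
Qed.

Lemma virtual_equiv_trans : transitive virtual_equiv.
Proof.
move=> g f h /asboolP[U [oU sU eU]] /asboolP[V [oV sV eV]].
apply/asboolP; exists (U `&` V); split; first exact: open_subgroupI.
- by move=> x [/sU[fx _] /sV[_ hx]].
- by move=> x /set_mem[Ux Vx]; rewrite eU ?eV//; exact: mem_set.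
Qed.

Canonical virtual_equiv_equiv :=
  EquivRel virtual_equiv virtual_equiv_refl virtual_equiv_sym
    virtual_equiv_trans.

Definition Comm := {eq_quot virtual_equiv}.
HB.instance Definition _ := Choice.on Comm.
HB.instance Definition _ := EqQuotient.on Comm.

Lemma pi_CommP f g :
  \pi_Comm f = \pi_Comm g <->
  exists U : set G, [/\ open_subgroup U, U `<=` vdom f `&` vdom g
                      & {in U, vfun f =1 vfun g}].
Proof.
by split=> [/eqmodP/asboolP//|fg]; apply/eqmodP/asboolP.
Qed.

Definition Comm_one : Comm := \pi_Comm virtual_id.
Definition Comm_inv (c : Comm) : Comm := \pi_Comm (virtual_inv (repr c)).
Definition Comm_mul (c1 c2 : Comm) : Comm :=
  \pi_Comm (virtual_comp (repr c1) (repr c2)).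

Lemma pi_comp f g :
  \pi_Comm (virtual_comp f g) = Comm_mul (\pi_Comm f) (\pi_Comm g).
Proof.
rewrite /Comm_mul; case: piP => f' /pi_CommP[U [oU sU eU]].
case: piP => g' /pi_CommP[V [oV sV eV]]; apply/pi_CommP.
exists (V `&` (vdom g `&` vfun g @^-1` U)); split.
- by apply: open_subgroupI => //; exact: open_subgroup_preimage.
- move=> x [Vx [gx /= Ux]]; have [_ g'x] := sV _ Vx.
  have [fx f'x] := sU _ Ux.
  by do 2?split => //=; rewrite -eV//; exact: mem_set.
- move=> x /set_mem[Vx [gx /= Ux]] /=.
  by rewrite -eV ?eU//; exact: mem_set.
Qed.

Lemma pi_inv f : \pi_Comm (virtual_inv f) = Comm_inv (\pi_Comm f).
Proof.
rewrite /Comm_inv; case: piP => f' /pi_CommP[U [oU sU eU]]; apply/pi_CommP.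
exists ((vcod f `&` vinv f @^-1` U) `&` vcod f'); split.
- apply: open_subgroupI; last exact: vcod_open.
  exact: (open_subgroup_preimage (virtual_inv f)).
- by move=> y [[fy _] f'y].
- move=> y /set_mem[[fy /= Uy] f'y] /=; have [_ f'x] := sU _ Uy.
  by rewrite -{2}(vinvK fy) eU ?vfunK//; exact: mem_set.
Qed.

Lemma Comm_mulA : associative Comm_mul.
Proof.
elim/quotW=> f; elim/quotW=> g; elim/quotW=> h.
rewrite -(pi_comp g h) -(pi_comp f g) -(pi_comp f) -(pi_comp _ h).
apply/pi_CommP; exists (vdom (virtual_comp f (virtual_comp g h))).
split; first exact: vdom_open.
- by move=> x [[hx /= gx] fx].
- by [].
Qed.

Lemma Comm_mul1 : left_id Comm_one Comm_mul.
Proof.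
elim/quotW=> f; rewrite /Comm_one -pi_comp; apply/pi_CommP.
by exists (vdom f); split=> //; exact: vdom_open.
Qed.

Lemma Comm_mulr1 : right_id Comm_one Comm_mul.
Proof.
elim/quotW=> f; rewrite /Comm_one -pi_comp; apply/pi_CommP.
by exists (vdom f); split=> //; exact: vdom_open.
Qed.

Lemma Comm_mulV : left_inverse Comm_one Comm_inv Comm_mul.
Proof.
elim/quotW=> f; rewrite -pi_inv -pi_comp; apply/pi_CommP.
exists (vdom f); split; first exact: vdom_open.
- by move=> x fx; split=> //; split=> //; exact: vfun_cod.
- by move=> x /set_mem fx /=; rewrite vfunK.
Qed.

Lemma Comm_mulrV : right_inverse Comm_one Comm_inv Comm_mul.
Proof.
elim/quotW=> f; rewrite -pi_inv -pi_comp; apply/pi_CommP.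
exists (vcod f); split; first exact: vcod_open.
- by move=> x fx; split=> //; split=> //; exact: vinv_dom.
- by move=> x /set_mem fx /=; rewrite vinvK.
Qed.

HB.instance Definition _ := isGroup.Build Comm
  Comm_mulA Comm_mul1 Comm_mulr1 Comm_mulV Comm_mulrV.

Lemma mul_CommE f g :
  \pi_Comm f * \pi_Comm g = \pi_Comm (virtual_comp f g).
Proof. by rewrite pi_comp. Qed.

(* The image in Comm of the topological automorphisms of U. *)
Definition Aut_in_Comm (U : set G) : set Comm :=
  [set \pi_Comm f | f in [set f | vdom f = U /\ vcod f = U]].

Definition AComm : set Comm :=
  generated_subgroup (\bigcup_(U in @open_subgroup G) Aut_in_Comm U).

End Commensurator.

Arguments Comm G : clear implicits.
Arguments AComm G : clear implicits.

(* Main.v *)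
From HB Require Import structures.
Require Import Defs.
From mathcomp Require Import all_boot.
From mathcomp Require Import fingroup morphism perm quotient gproduct.
From mathcomp Require Import zmodp cyclic pgroup.
From mathcomp Require Import gseries maximal.
From mathcomp Require Import boolp classical_sets functions cardinality.
From mathcomp Require Import topology.

Set Implicit Arguments.
Unset Strict Implicit.
Unset Printing Implicit Defensive.

Local Open Scope classical_set_scope.
Local Open Scope group_scope.

(** The proof rests on two facts about a free pro-p group W of finite rank n,
    embedded as an open subgroup of F.

    Transitivity. A subgroup M that is normal of index p in W is the kernel of
    a character W -> Z/p. By transvections and rescaling one finds a basis of W
    on which this character is a coordinate function ([adapted_basis]).
    Mapping an adapted basis to another shows that Aut W permutes the
    subgroups M transitively ([normal_index_p_transitive]).

    Rank. If t, x_1, ..., x_(n-1) is adapted to M, then t^p and the conjugates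
    t^j x_i t^-j with 0 <= j < p form a basis of M ([schreier_basis_free]), so
    that M is free of rank 1 + p(n - 1).

    An open subgroup U of F is reached from F by a chain of subgroups, each
    normal of index p in the previous one ([normal_chain_exists]), because
    proper subgroups of finite p-groups lie in normal subgroups of index p.
    If F is not abelian, its rank is at least 2, the rank grows strictly along
    such a chain, and the length of the chain is determined by the rank of U,
    which is an isomorphism invariant. Hence, when f : U -> V is an isomorphism
    of open subgroups, U and V are reached by chains of the same length k.
    Induction on k, with transitivity at each level, gives an isomorphism
    g : U -> V that is a product of restrictions of automorphisms of open
    subgroups ([normal_chain_iso]). Then [f] = [g] [g^-1 f], where g^-1 f is an
    automorphism of U.

    Freeness is handled through finite p-groups: [free_basis] asks for
    topological generation and for the extension of maps to finite p-groups.
    This form passes to subgroups of index p by a finite wreath product, and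
    compactness recovers from it homomorphisms into F itself
    ([basis_ext_profinite]), hence isomorphisms between free open subgroups of
    equal rank ([basis_iso]). *)

(** * Open normal subgroups of profinite groups *)

Section QuasiComponent.
Variables (T : topologicalType) (x : T).
Hypotheses (cT : compact [set: T]) (hT : hausdorff_space T).

Let clopens : set (set T) := [set C | clopen C /\ C x].
Let Q : set T := \bigcap_(C in clopens) C.

(** The complement of W is compact and covered by the complements of the clopen
    neighbourhoods of x, which are stable under finite intersections. *)
Lemma clopen_between_quasi_component (W : set T) :
  open W -> Q `<=` W -> exists C, [/\ clopen C, C x & C `<=` W].
Proof.
move=> oW QW; pose F := filter_from clopens id.
have FF : Filter F.
  apply: filter_from_filter; first by exists setT; split => //; exact: clopenT.
  by move=> A B [? ?] [? ?]; exists (A `&` B) => //; split=> //; exact: clopenI.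
have PF : ProperFilter F by apply: filter_from_proper => C [_ Cx]; exists x.
have /(iffLR (compact_near_coveringP _)) : compact (~` W).
  by apply: (subclosed_compact _ cT) => //; exact: open_closedC.
move=> /(_ _ _ setC (powerset_filter_from_filter PF))[].
  move=> y nWy; have [C [[oC cC] Cx] nCy] : exists2 C, clopens C & ~ C y.
    apply: contrapT => nC; apply: nWy; apply: QW => C CC.
    by apply: contrapT => nCy; apply: nC; exists C.
  exists (~` C, [set U | U `<=` C]); first split.
  - by apply: open_nbhs_nbhs; split => //; exact: closed_openC.
  - apply/near_powerset_filter_fromP; first by move=> ? ?; exact: subset_trans.
    by exists C => //; exists C.
  - by case=> i j [? /subsetC]; apply.
move=> D [DF _ [A DA]] /(_ _ DA)/subsetC2 AW.
by have [C [clC Cx] CA] := DF _ DA; exists C; split=> //;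
  exact: subset_trans AW.
Qed.

(** If the quasi-component splits into disjoint closed sets A and B, normality
    separates them by an open U; a clopen neighbourhood C of x that avoids the
    boundary of U gives the clopen set C `&` U, which contains the
    quasi-component but is disjoint from B. *)
Lemma quasi_component_connected : connected Q.
Proof.
have Qx : Q x by move=> C [].
have cQ : closed Q by apply: closed_bigI => C [[]].
have key (A B : set T) : closed A -> closed B -> A `&` B = set0 ->
    Q = A `|` B -> A x -> B = set0.
  move=> cA cB AB0 QAB Ax.
  have [|U AU UB] := @compact_normal T hT cT A cA (~` B).
    apply/set_nbhsP; exists (~` B); split=> //; first exact: closed_openC.
    by apply/disjoints_subset.
  have {AU UB U}[U [oU AU UB]] :
      exists U, [/\ open U, A `<=` U & closure U `<=` ~` B].
    have /set_nbhsP[V [oV AV VU]] := AU; exists V; split=> //.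
    by apply: subset_trans UB; exact: closureS.
  have [||C [[oC cC] Cx CW]] :=
    @clopen_between_quasi_component (U `|` ~` closure U).
  - by apply: openU => //; apply: closed_openC; exact: closed_closure.
  - rewrite QAB => y [/AU|By]; first by left.
    by right=> /UB; exact.
  have CUE : C `&` U = C `&` closure U.
    apply/seteqP; split=> y [Cy Uy]; split=> //; first exact: subset_closure.
    by case: (CW _ Cy).
  have clCU : clopens (C `&` U).
    split; last by split=> //; exact: AU.
    split; first exact: openI.
    by rewrite CUE; apply: closedI => //; exact: closed_closure.
  apply/seteqP; split=> // y By.
  have /(_ _ clCU)[_ Uy] : Q y by rewrite QAB; right.
  by apply: (UB y) => //; exact: subset_closure.
move=> B B0 [O oO BO] [K cK BK].
have cB : closed B by rewrite BK; exact: closedI.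
pose A := Q `&` ~` O.
have cA : closed A by apply: closedI => //; exact: open_closedC.
have AB : A `&` B = set0.
  by rewrite BO; apply/seteqP; split=> // y [[_ nO] [_]].
have QE : Q = A `|` B.
  rewrite BO; apply/seteqP; split=> y; last by case=> -[].
  by move=> Qy; have [Oy|nOy] := pselect (O y); [right|left].
have [Ax|Bx] : (A `|` B) x by rewrite -QE.
  by move: B0; rewrite (key _ _ cA cB AB QE Ax) => -[].
have A0 : A = set0 by apply: (key B A) => //; [rewrite setIC|rewrite setUC].
by move: QE; rewrite A0 set0U => ->.
Qed.

Lemma clopen_nbhs_basis (W : set T) :
  connected_component [set: T] x = [set x] -> open W -> W x ->
  exists C, [/\ clopen C, C x & C `<=` W].
Proof.
move=> ccx oW Wx; apply: clopen_between_quasi_component => // y Qy.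
suff: connected_component [set: T] x y by rewrite ccx => ->.
by exists Q => //; split=> //; [move=> C []|exact: quasi_component_connected].
Qed.

End QuasiComponent.

Section TopologicalGroups.
Variable G : topGroupType.

Lemma cvgM_group (T : Type) (A : set_system T) (f g : T -> G) (a b : G) :
  Filter A -> f @ A --> a -> g @ A --> b -> (fun t => f t * g t) @ A --> a * b.
Proof.
move=> FA fa gb.
exact: (cvg_comp _ _ (cvg_pair fa gb) (@mulg_continuous G (a, b))).
Qed.

Lemma cvgV_group (T : Type) (A : set_system T) (f : T -> G) (a : G) :
  Filter A -> f @ A --> a -> (fun t => (f t)^-1) @ A --> a^-1.
Proof. by move=> FA fa; exact: (cvg_comp _ _ fa (@invg_continuous G a)). Qed.

Lemma mull_continuous (a : G) : continuous (fun x : G => a * x).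
Proof. by move=> x; apply: cvgM_group; [exact: cvg_cst|exact: cvg_id]. Qed.

Lemma subgroup_nbhs1_open (A : set G) : subgroup A -> nbhs 1 A -> open A.
Proof.
move=> [A1 AM AV] nA; rewrite openE => a Aa; rewrite /interior.
have nB : nbhs a ((fun x => a^-1 * x) @^-1` A).
  by apply: (@mull_continuous a^-1 a A); rewrite mulVg.
apply: filterS nB => x /= Ax; rewrite -(mulVKg a x); exact: AM.
Qed.

Lemma open_subgroup_sup (A B : set G) :
  subgroup A -> open B -> B 1 -> B `<=` A -> open_subgroup A.
Proof.
move=> sA oB B1 BA; split=> //; apply: subgroup_nbhs1_open => //.
by apply: (filterS BA); apply: open_nbhs_nbhs.
Qed.

(** For a clopen neighbourhood C of 1 inside W, the elements n such that every
    conjugate of n and of n^-1 maps C into itself by right multiplication form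
    a normal subgroup contained in C. Compactness of G `*` C makes it a
    neighbourhood of 1. *)
Lemma open_normal_subgroup_basis (W : set G) :
  profinite G -> open W -> W 1 ->
  exists N, [/\ open N, normal_subgroup N & N `<=` W].
Proof.
move=> [cG hG tG] oW W1.
have [C [[oC cC] C1 CW]] := clopen_nbhs_basis cG hG (tG 1 I) oW W1.
pose S : set G := [set n | forall g c, C c -> C (c * n ^ g)].
have nS : nbhs 1 S.
  have : compact ([set: G] `*` C).
    by apply: compact_setX => //; exact: (subclosed_compact cC cG).
  move=> /compact_near_coveringP/(_ _ (nbhs (1 : G))
    (fun n gc => C (gc.2 * n ^ gc.1)) _) cov.
  have cnt (g c : G) : (fun t : (G * G) * G => t.1.2 * t.2 ^ t.1.1) @
      nbhs ((g, c), (1 : G)) --> c * 1 ^ g.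
    have cg : (fun t : (G * G) * G => t.1.1) @ nbhs ((g, c), (1 : G)) --> g.
      exact: (cvg_comp _ _ (@cvg_fst _ _ _ _ _) (@cvg_fst _ _ _ _ _)).
    have cc : (fun t : (G * G) * G => t.1.2) @ nbhs ((g, c), (1 : G)) --> c.
      exact: (cvg_comp _ _ (@cvg_fst _ _ _ _ _) (@cvg_snd _ _ _ _ _)).
    have cn : (fun t : (G * G) * G => t.2) @ nbhs ((g, c), (1 : G)) --> (1 : G).
      exact: cvg_snd.
    apply: cvgM_group => //; apply: cvgM_group; first exact: cvgV_group.
    exact: cvgM_group.
  have : \forall n \near nbhs (1 : G), [set: G] `*` C `<=`
      (fun gc => C (gc.2 * n ^ gc.1)).
    apply: cov => -[g c] [_ /= Cc].
    by apply: (cnt g c C); rewrite conj1g mulg1; apply: open_nbhs_nbhs.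
  by apply: filterS => n nC g c Cc; exact: (nC (g, c)).
exists (S `&` [set n | S n^-1]).
have nN : normal_subgroup (S `&` [set n | S n^-1]).
  have SM x y : S x -> S y -> S (x * y).
    by move=> Sx Sy g c Cc; rewrite conjMg mulgA; apply: Sy; exact: Sx.
  have SJ x y : S x -> S (x ^ y).
    by move=> Sx g c Cc; rewrite -conjgM; exact: Sx.
  have S1 : S 1 by move=> g c; rewrite conj1g mulg1.
  split; first split.
  - by split=> //=; rewrite invg1.
  - by move=> x y [Sx Sx'] [Sy Sy']; split => /=; rewrite ?invgM; exact: SM.
  - by move=> x [Sx Sx']; split => //=; rewrite invgK.
  - by move=> x y [Sx Sx']; split => /=; rewrite -?conjVg; exact: SJ.
split=> //.
- apply: subgroup_nbhs1_open; first by case: nN.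
  apply: filterI => //; apply: (@invg_continuous G 1 S).
  by rewrite invg1.
- by move=> x [Sx _]; apply: CW; have := Sx 1 1 C1; rewrite mul1g conjg1.
Qed.

End TopologicalGroups.

(** * Homomorphisms defined on open subgroups *)

Section HomOn.
Variables (G H : groupType) (W : set G).
Hypothesis sW : subgroup W.

Definition hom_on (f : G -> H) : Prop :=
  forall a b, W a -> W b -> f (a * b) = f a * f b.

Lemma hom_on1 f : hom_on f -> f 1 = 1.
Proof.
case: sW => W1 _ _ fM.
by apply: (mulgI (f 1)); rewrite -fM // !mulg1.
Qed.

Lemma hom_onV f a : hom_on f -> W a -> f a^-1 = (f a)^-1.
Proof.
case: sW => W1 _ WV fM Wa; apply: (mulgI (f a)).
by rewrite -fM ?mulgV ?(hom_on1 fM) //; exact: WV.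
Qed.

Lemma subgroupX a n : W a -> W (a ^+ n).
Proof.
by case: sW => W1 WM _ Wa; elim: n => [//|n IH]; rewrite expgS; exact: WM.
Qed.

Lemma subgroupJ a b : W a -> W b -> W (a ^ b).
Proof.
by case: sW => _ WM WV Wa Wb; rewrite conjgE; apply: (WM); [exact: WV|exact: WM].
Qed.

Lemma hom_onX f a n : hom_on f -> W a -> f (a ^+ n) = f a ^+ n.
Proof.
move=> fM Wa; elim: n => [|n IH]; first by rewrite (hom_on1 fM).
by rewrite !expgS fM ?IH //; exact: subgroupX.
Qed.

Lemma hom_on_preimage f (S : set H) :
  hom_on f -> subgroup S -> subgroup (W `&` f @^-1` S).
Proof.
move=> fM [S1 SM SV]; case: (sW) => W1 WM WV; split.
- by split=> //=; rewrite (hom_on1 fM).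
- by move=> x y [Wx Sx] [Wy Sy]; split; [exact: WM|rewrite /= fM //; exact: SM].
- move=> x [Wx Sx]; split; first exact: WV.
  by rewrite /= (hom_onV fM) //; exact: SV.
Qed.

Lemma hom_on_equalizer f g :
  hom_on f -> hom_on g -> subgroup (W `&` [set a | f a = g a]).
Proof.
move=> fM gM; case: (sW) => W1 WM WV; split.
- by split=> //=; rewrite (hom_on1 fM) (hom_on1 gM).
- move=> x y [Wx /= ex] [Wy /= ey]; split; first exact: WM.
  by rewrite /= fM // gM // ex ey.
- move=> x [Wx /= ex]; split; first exact: WV.
  by rewrite /= (hom_onV fM) // (hom_onV gM) // ex.
Qed.

End HomOn.

Lemma subgroup1 (G : groupType) : subgroup [set (1 : G)].
Proof.
split=> [//|x y -> ->|x ->] /=; first by rewrite mulg1.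
by rewrite invg1.
Qed.

Lemma morph_one (G H : groupType) (f : G -> H) :
  {morph f : a b / a * b} -> f 1 = 1.
Proof. by move=> fM; apply: (mulgI (f 1)); rewrite -fM !mulg1. Qed.

Section FiniteHom.
Variables (G : topGroupType).

(** Continuous homomorphisms from the open subgroup W to the discrete group H;
    H may be given without a topology since continuity only says that the
    kernel is open. *)
Definition finite_hom (W : set G) (H : groupType) (f : G -> H) : Prop :=
  hom_on W f /\ open (W `&` f @^-1` [set 1]).

Lemma finite_hom_preimage (W : set G) (H : groupType) (f : G -> H) (S : set H) :
  open_subgroup W -> finite_hom W f -> subgroup S ->
  open_subgroup (W `&` f @^-1` S).
Proof.
move=> [oW sW] [fM fo] sS; have [S1 _ _] := sS.
apply: open_subgroup_sup (hom_on_preimage sW fM sS) fo _ _.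
  by split; [case: sW|exact: hom_on1 fM].
by move=> x [Wx /= ->].
Qed.

Lemma finite_hom_ker (W : set G) (H : groupType) (f : G -> H) :
  open_subgroup W -> finite_hom W f -> open_subgroup (W `&` f @^-1` [set 1]).
Proof.
by move=> oW fh; apply: finite_hom_preimage => //; exact: subgroup1.
Qed.

Lemma finite_hom_equalizer (W : set G) (H : groupType) (f g : G -> H) :
  open_subgroup W -> finite_hom W f -> finite_hom W g ->
  open_subgroup (W `&` [set a | f a = g a]).
Proof.
move=> oW fh gh; have [_ sW] := oW.
have [oK [K1 _ _]] :=
  open_subgroupI (finite_hom_ker oW fh) (finite_hom_ker oW gh).
apply: open_subgroup_sup (hom_on_equalizer sW fh.1 gh.1) oK K1 _.
by move=> x [[Wx /= ->] [_ /= ->]].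
Qed.

(** W lies in the closed subgroup generated by x, as that closed subgroup is
    the intersection of the open subgroups that contain x. *)
Definition topgen (I : Type) (W : set G) (x : I -> G) : Prop :=
  forall U, open_subgroup U -> (forall i, U (x i)) -> W `<=` U.

Lemma finite_hom_ext (I : Type) (W : set G) (x : I -> G) (H : groupType)
    (f g : G -> H) :
  open_subgroup W -> topgen W x -> (forall i, W (x i)) ->
  finite_hom W f -> finite_hom W g -> (forall i, f (x i) = g (x i)) ->
  forall a, W a -> f a = g a.
Proof.
move=> oW gx Wx fh gh fg a Wa.
have [//|_ ->//] := gx _ (finite_hom_equalizer oW fh gh) _ _ Wa.
by move=> i; split; [exact: Wx|exact: fg].
Qed.

(** The quotient G / N is realized on the ordinals below p ^ k by transporting
    the product along a numbering of the cosets. *)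
Lemma finite_p_quotient (p : nat) (N : set G) :
  prime p -> pro_p p G -> open N -> normal_subgroup N ->
  exists (gT : finGroupType) (q : G -> gT),
    [/\ p.-group [set: gT]%SET, {morph q : a b / a * b} &
        forall a, q a = 1 <-> N a].
Proof.
move=> p_pr [_ pG] oN nN; have [k] := pG N oN nN.
have [[N1 NM NV] NJ] := nN.
move=> /card_set_bijP[c [cf ci cs]].
pose coset a := [set a * n | n in N].
have cosetE a b : coset a = coset b <-> N (a^-1 * b).
  split=> [E|Nab].
    have [n Nn <-] : coset a b by rewrite E; exists 1; rewrite ?mulg1.
    by rewrite mulKg.
  have Nba : N (b^-1 * a) by rewrite -(invgK a) -invgM; exact: NV.
  apply/seteqP; split=> _ [n Nn <-].
    by exists (b^-1 * a * n); [exact: NM|rewrite mulgA mulVKg].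
  by exists (a^-1 * b * n); [exact: NM|rewrite mulgA mulVKg].
have cl a : (c (coset a) < p ^ k)%N by apply: cf; exists a.
pose kap a : 'I_(p ^ k) := Ordinal (cl a).
have kapE a b : kap a = kap b <-> N (a^-1 * b).
  rewrite -cosetE; split=> [[]|E]; last by apply: val_inj; rewrite /= E.
  by apply: ci; apply/mem_set; [exists a|exists b].
have kapS (i : 'I_(p ^ k)) : exists a, kap a = i.
  have [|_ [a _ <-] ca] := cs i; first exact: ltn_ord.
  by exists a; apply: val_inj; rewrite /= ca.
pose r i := xget 1 [set a | kap a = i].
have rK i : kap (r i) = i.
  by rewrite /r; case: xgetP => // na; have [a /na] := kapS i.
have kapM a b a' b' : kap a = kap a' -> kap b = kap b' ->
    kap (a * b) = kap (a' * b').
  move=> /kapE Na /kapE Nb; apply/kapE.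
  have -> : (a * b)^-1 * (a' * b') = (a^-1 * a') ^ b * (b^-1 * b').
    by rewrite conjgE invgM !mulgA mulgK.
  by apply: NM => //; exact: NJ.
pose mul i j := kap (r i * r j).
have mulE a b : mul (kap a) (kap b) = kap (a * b) by apply: kapM; rewrite rK.
have kapI (P : 'I_(p ^ k) -> Prop) : (forall a, P (kap a)) -> forall i, P i.
  by move=> Pk i; rewrite -(rK i).
have mA : associative mul.
  by elim/kapI=> a; elim/kapI=> b; elim/kapI=> d; rewrite !mulE mulgA.
have m1 : left_id (kap 1) mul by elim/kapI=> a; rewrite mulE mul1g.
have mV : left_inverse (kap 1) (fun i => kap (r i)^-1) mul.
  by move=> i; rewrite -{2}(rK i) mulE mulVg.
pose gT : finGroupType :=
  HB.pack 'I_(p ^ k) (Finite_isGroup.Build 'I_(p ^ k) mA m1 mV).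
exists gT, kap; split.
- by rewrite /pgroup cardsT card_ord pnatX pnat_id.
- by move=> a b; rewrite -mulE.
- move=> a; rewrite -[1]/(kap 1); split=> [/esym/kapE|Na].
    by rewrite invg1 mul1g.
  by apply/esym/kapE; rewrite invg1 mul1g.
Qed.

End FiniteHom.

(** * Normal subgroups of index p *)

(** The quotient P / M is cyclic of order p; chi is the projection followed by
    the isomorphism with Z/p determined by a generator. *)
Lemma maximal_subgroup_character (p : nat) (gT : finGroupType)
    (M P : {group gT}) :
  prime p -> p.-group P -> maximal M P ->
  exists chi : gT -> 'Z_p,
    [/\ {in P &, {morph chi : x y / x * y}},
        forall x, x \in P -> chi x = 1 <-> x \in M &
        exists2 x, x \in P & chi x = Zp1].
Proof.
move=> p_pr pP maxM; have nM := p_maximal_normal pP maxM.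
have oPM : #|(P / M)%g| = p.
  by rewrite card_quotient ?normal_norm ?(p_maximal_index pP maxM).
have /cyclicP[c cE] : cyclic (P / M)%g by rewrite prime_cyclic ?oPM.
have oc : p = #[c] by rewrite orderE -cE oPM.
have /morphimP[x Nx Px cx] : c \in (P / M)%g by rewrite cE cycle_id.
clear oPM; subst p; pose f := invm_morphism (injm_Zpm c).
have inf a : a \in P -> coset M a \in (Zpm @* Zp #[c])%g.
  by move=> Pa; rewrite im_Zpm -cE mem_quotient.
have nN a : a \in P -> a \in 'N(M)%g by move/(fintype.subsetP (normal_norm nM)).
exists (fun a => f (coset M a)); split.
- by move=> a b Pa Pb; rewrite morphM ?nN // morphM ?inf.
- move=> a Pa; split=> [fa1|Ma]; last by rewrite coset_id ?morph1.
  apply: coset_idr; first exact: nN.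
  have injf : 'injm f := injm_invm (injm_Zpm c).
  by apply: (injmP injf); rewrite ?inf ?group1 // fa1 morph1.
- exists x => //.
  have -> : coset M x = Zpm (Zp1 : 'Z_#[c]).
    have cZ : c ^+ 1 = Zpm (Zp1 : 'Z_#[c]).
      by rewrite /Zpm /= modn_small // Zp_cast ?prime_gt1.
    by rewrite -cZ expg1 cx.
  by rewrite /f /= invmE //= /Zp (prime_gt1 p_pr) inE.
Qed.

Section Steps.
Variables (p : nat) (G : topGroupType).
Hypotheses (p_pr : prime p) (pG : pro_p p G).

(** An open subgroup that is normal of index p in W, presented as the kernel of
    a character: characters can be compared on a basis and transported along
    isomorphisms. *)
Definition normal_index_p (W M : set G) : Prop :=
  exists phi : G -> 'Z_p, [/\ finite_hom W phi, exists2 t, W t & phi t = Zp1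
    & M = W `&` phi @^-1` [set 1]].

Lemma normal_index_p_open W M :
  open_subgroup W -> normal_index_p W M -> open_subgroup M.
Proof. by move=> oW [phi [fh _ ->]]; exact: finite_hom_ker. Qed.

Lemma finite_p_quotient_below (U : set G) : open_subgroup U ->
  exists (gT : finGroupType) (q : G -> gT),
    [/\ p.-group [set: gT]%SET, {morph q : a b / a * b},
        open (q @^-1` [set 1]) & q @^-1` [set 1] `<=` U].
Proof.
move=> [oU [U1 _ _]].
have [N [oN nN NU]] := open_normal_subgroup_basis pG.1 oU U1.
have [gT [q [pgT qM qN]]] := finite_p_quotient p_pr pG oN nN.
have qE : q @^-1` [set 1] = N by apply/seteqP; split=> a /qN.
by exists gT, q; rewrite qE.
Qed.

Section ImageGroup.
Variables (gT : finGroupType) (q : G -> gT).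
Hypothesis qM : {morph q : a b / a * b}.

Definition finite_image (W : set G) : {set gT} :=
  [set g | `[< exists2 w, W w & q w = g >]]%SET.

Lemma finite_imageP (W : set G) g :
  reflect (exists2 w, W w & q w = g) (g \in finite_image W).
Proof. by rewrite inE; exact: asboolP. Qed.

Lemma finite_image_group_set (W : set G) :
  subgroup W -> group_set (finite_image W).
Proof.
move=> [W1 WM WV]; have q1 : q 1 = 1.
  by apply: (mulgI (q 1)); rewrite -qM !mulg1.
apply/group_setP; split; first by apply/finite_imageP; exists 1.
move=> _ _ /finite_imageP[a Wa <-] /finite_imageP[b Wb <-]; apply/finite_imageP.
by exists (a * b); [exact: WM|exact: qM].
Qed.

Lemma finite_imageE (U : set G) a : subgroup U -> q @^-1` [set 1] `<=` U ->
  q a \in finite_image U -> U a.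
Proof.
move=> [U1 UM UV] NU /finite_imageP[u Uu quE].
rewrite -(mulVKg u a); apply: UM => //; apply: NU => /=.
by rewrite qM -quE -qM mulVg (morph_one qM).
Qed.

End ImageGroup.

(** In the finite p-group which is the image of W, the image of U lies in a
    maximal subgroup, and M is its preimage. The cardinal of the image is the
    measure that decreases when this lemma is iterated. *)
Lemma normal_index_p_above (gT : finGroupType) (q : G -> gT) (U W : set G) :
  p.-group [set: gT]%SET -> {morph q : a b / a * b} ->
  open (q @^-1` [set 1]) -> q @^-1` [set 1] `<=` U ->
  open_subgroup U -> open_subgroup W -> U `<=` W -> U <> W ->
  exists M, [/\ normal_index_p W M, U `<=` M &
    (#|finite_image q M| < #|finite_image q W|)%N].
Proof.
move=> pgT qM oN NU [oU sU] [oW sW] UW nUW.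
pose A := Group (finite_image_group_set qM sU).
pose P := Group (finite_image_group_set qM sW).
have pP : p.-group P by apply: pgroupS pgT; exact: finset.subsetT.
have sAP : A \subset P.
  apply/fintype.subsetP => _ /finite_imageP[u Uu <-].
  by apply/finite_imageP; exists u => //; exact: UW.
have [/= AP|[M0 maxM sAM]] := maximal_exists sAP.
  case: nUW; apply/seteqP; split=> // w Ww.
  by apply: (finite_imageE qM sU NU); rewrite [finite_image q U]AP;
    apply/finite_imageP; exists w.
have [chi [chiM chiE [c Pc chic]]] := maximal_subgroup_character p_pr pP maxM.
have Pq w : W w -> q w \in P by move=> Ww; apply/finite_imageP; exists w.
have fh : finite_hom W (chi \o q).
  have hM : hom_on W (chi \o q).
    by move=> a b Wa Wb /=; rewrite qM chiM ?Pq.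
  have q1 := morph_one qM.
  split=> //; apply: (open_subgroup_sup _ oN q1 _).1.
    by apply: hom_on_preimage => //; exact: subgroup1.
  move=> a /= qa; split; first exact/UW/NU.
  by rewrite /= qa -q1; apply: hom_on1 hM.
exists (W `&` (chi \o q) @^-1` [set 1]); split.
- exists (chi \o q); split=> //.
  by case/finite_imageP: Pc => w Ww qw; exists w; rewrite //= qw.
- move=> u Uu; split; first exact: UW.
  apply/chiE; first by apply: Pq; exact: UW.
  by apply: (fintype.subsetP sAM); apply/finite_imageP; exists u.
- apply: (@leq_ltn_trans #|M0|).
    apply: subset_leq_card; apply/fintype.subsetP.
    move=> _ /finite_imageP[w [Ww qw1] <-].
    by apply/chiE; [exact: Pq|exact: qw1].
  by apply: proper_card; exact: maxgroupp maxM.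
Qed.

End Steps.

(** * Free bases *)

Lemma finite_hom_cst1 (G : topGroupType) (W : set G) (H : groupType) :
  open W -> finite_hom W (fun=> 1 : H).
Proof.
move=> oW; split; first by move=> a b _ _; rewrite mulg1.
by rewrite (_ : _ `&` _ = W) //; apply/seteqP; split=> // x [].
Qed.

Lemma finite_hom_comp (G : topGroupType) (W : set G) (H K : groupType)
    (f : G -> H) (h : H -> K) :
  open_subgroup W -> finite_hom W f -> {morph h : a b / a * b} ->
  finite_hom W (h \o f).
Proof.
move=> oW fh hM; have [_ sW] := oW; have [oK [K1 _ _]] := finite_hom_ker oW fh.
have hfM : hom_on W (h \o f) by move=> a b Wa Wb /=; rewrite fh.1 // hM.
split=> //; apply: (open_subgroup_sup _ oK K1 _).1.
  by apply: hom_on_preimage => //; exact: subgroup1.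
move=> a [Wa /= fa]; split=> //=; rewrite fa.
exact: morph_one.
Qed.

(** Raising to a power m is an automorphism of Z/p that takes the generator c to
    the standard generator. *)
Lemma Zp_rescale (p : nat) (c : 'Z_p) : prime p -> c <> 1 ->
  exists m, c ^+ m = Zp1 /\ forall z : 'Z_p, z ^+ m = 1 -> z = 1.
Proof.
move=> p_pr c1; have p1 := prime_gt1 p_pr.
have expp (z : 'Z_p) : z ^+ p = 1.
  apply/eqP; rewrite -order_dvdn.
  have := order_dvdG (finset.in_setT z : z \in [set: 'Z_p]%G).
  by rewrite cardsT card_ord Zp_cast.
have oc : #[c] = p.
  have: #[c] %| p by rewrite order_dvdn expp.
  rewrite (dvdn_prime2 _ p_pr) => [/eqP //|].
  have [_ /(_ #[c])] := primeP p_pr; rewrite order_dvdn expp eqxx => /(_ isT).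
  by rewrite order_eq1 => /orP[/eqP //|/eqP ->].
have cT : <[c]> = [set: 'Z_p]%SET.
  apply/eqP; rewrite eqEcard finset.subsetT cardsT card_ord Zp_cast //.
  by rewrite -orderE oc /=.
have gen z : exists k, z = c ^+ k.
  by apply/cycleP; rewrite cT inE.
have [m cm] := gen Zp1; exists m; split=> // z; have [k ->] := gen z.
rewrite -expgM mulnC expgM -cm => /eqP; rewrite -order_dvdn.
have -> : #[Zp1 : 'Z_p] = p by rewrite order_Zp1; exact: Zp_cast.
by case/dvdnP=> l ->; rewrite mulnC expgM expp expg1n.
Qed.

Section FreeBasis.
Variables (p : nat) (G : topGroupType).
Hypotheses (p_pr : prime p).

(** W is free pro-p on x. Extension is asked for finite p-groups only, which
    keeps the constructions on subgroups of index p finite; uniqueness of the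
    extension follows from topological generation. *)
Record free_basis (I : finType) (W : set G) (x : I -> G) : Prop := FreeBasis {
  basis_open : open_subgroup W;
  basis_in : forall i, W (x i);
  basis_gen : topgen W x;
  basis_ext : forall gT : finGroupType, p.-group [set: gT]%SET ->
    forall y : I -> gT, exists f : G -> gT,
      finite_hom W f /\ forall i, f (x i) = y i }.

Lemma free_basis_reindex (I J : finType) (W : set G) (x : I -> G) (h : J -> I)
    (h' : I -> J) : cancel h h' -> cancel h' h ->
  free_basis W x -> free_basis W (x \o h).
Proof.
move=> hK h'K [oW Wx gx ex]; split=> //.
- by move=> i; exact: Wx.
- by move=> U oU Ux; apply: gx => // i; rewrite -(h'K i); exact: Ux.
- move=> gT pgT y; have [f [fh fx]] := ex gT pgT (y \o h').
  by exists f; split=> // j; rewrite /= fx /= hK.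
Qed.

Lemma free_basis_transvection (I : finType) (W : set G) (x : I -> G) (i0 : I)
    (k : I -> nat) :
  free_basis W x ->
  free_basis W (fun i => if i == i0 then x i0 else x i * (x i0) ^- k i).
Proof.
move=> [oW Wx gx ex]; have [_ sW] := oW; have [W1 WM WV] := sW.
have Wk i : W ((x i0) ^- k i) by apply: WV; exact: subgroupX.
split=> //.
- by move=> i; case: eqP => // _; exact: WM.
- move=> U oU Ux; have [_ sU] := oU; have [U1 UM UV] := sU.
  have Ux0 : U (x i0) by have := Ux i0; rewrite eqxx.
  apply: gx => // i; have := Ux i; case: eqP => [->//|_ Uxi].
  by rewrite -(mulgVK (x i0 ^+ k i) (x i)); apply: UM => //; exact: subgroupX.
- move=> gT pgT y.
  have [f [fh fx]] := ex gT pgT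
    (fun i => if i == i0 then y i0 else y i * y i0 ^+ k i).
  exists f; split=> // i; case: eqP => [->|/eqP/negbTE ni].
    by rewrite fx /= eqxx.
  have fM := fh.1; rewrite fM // (hom_onV sW fM); last exact: subgroupX.
  rewrite (hom_onX sW _ fM) //.
  by rewrite !fx /= ni eqxx mulgK.
Qed.

Lemma pgroup_Zp : p.-group [set: 'Z_p]%SET.
Proof. by rewrite /pgroup cardsT card_ord Zp_cast ?prime_gt1 // pnat_id. Qed.

Lemma Zp1_neq1 : (Zp1 : 'Z_p) <> 1.
Proof. by []. Qed.

(** The character defining M is nontrivial on some x i1; rescaling makes its
    value there the standard generator, and multiplying the other x i by powers
    of x i1 makes its values there trivial. A transposition moves i1 to the
    prescribed place i0. *)
Lemma adapted_basis (I : finType) (W M : set G) (x : I -> G) (i0 : I) :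
  free_basis W x -> normal_index_p p W M ->
  exists (x' : I -> G) (phi : G -> 'Z_p),
    [/\ free_basis W x', finite_hom W phi, M = W `&` phi @^-1` [set 1],
        phi (x' i0) = Zp1 & forall i, i != i0 -> phi (x' i) = 1].
Proof.
move=> fx [phi [fh [t Wt pt] ->]]; have [oW Wx gx _] := fx; have [_ sW] := oW.
have [i1 /eqP c1] : exists i1, phi (x i1) != 1.
  apply: contrapT => /forallNP h; apply: Zp1_neq1; rewrite -pt.
  apply: (finite_hom_ext oW gx Wx fh (finite_hom_cst1 _ oW.1)) => // i.
  by apply/eqP; rewrite -[_ == _]negbK; apply/negP; exact: h.
have [m [cm mK]] := Zp_rescale p_pr c1.
pose psi := (fun z : 'Z_p => z ^+ m) \o phi.
have psih : finite_hom W psi.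
  by apply: finite_hom_comp => // a b /=; rewrite expgMn //; exact: Zp_mulgC.
pose x' i := if i == i1 then x i1 else x i * (x i1) ^- (psi (x i)).
have fx' : free_basis W x' by exact: free_basis_transvection.
exists (x' \o tperm i0 i1), psi; split.
- by apply: (free_basis_reindex (h' := tperm i0 i1)) => //; exact: tpermK.
- by [].
- apply/seteqP; split=> a [Wa /= pa]; split=> //=; last exact: mK.
  by rewrite /psi /= pa expg1n.
- by rewrite /= tpermL /x' eqxx.
- move=> i ni; rewrite /= /x' ifF; last first.
    by rewrite -(inj_eq (@perm_inj _ (tperm i0 i1))) tpermK tpermR; exact/negbTE.
  set j := tperm i0 i1 i; have pM := psih.1.
  have sWX n := subgroupX sW n (Wx i1).
  have [_ _ WV] := sW.
  rewrite pM // ?(hom_onV sW pM) //; last exact: WV.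
  by rewrite (hom_onX sW _ pM) // [psi (x i1)]cm Zp1_expgz mulgV.
Qed.

End FreeBasis.

(** * Subgroups of index p of free groups *)

Section Wreath.
Variables (p : nat) (gT : finGroupType).

(** The wreath product of gT by Z/p; the product type is renamed because it
    already carries the direct product structure. *)
Definition wreath : Type := ({ffun 'Z_p -> gT} * 'Z_p)%type.
HB.instance Definition _ := Finite.copy wreath ({ffun 'Z_p -> gT} * 'Z_p)%type.

Let mul (u v : wreath) : wreath :=
  ([ffun j => u.1 j * v.1 (j * u.2)], u.2 * v.2).
Let one : wreath := ([ffun=> 1], 1).
Let inv (u : wreath) : wreath :=
  ([ffun j => (u.1 (j * u.2^-1))^-1], u.2^-1).

Let wreath_mulA : associative mul.
Proof.
move=> u v w; congr pair; rewrite /= ?mulgA //.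
by apply/ffunP => j; rewrite !ffunE /= !mulgA.
Qed.

Let wreath_mul1 : left_id one mul.
Proof.
move=> [u k]; congr pair; rewrite /= ?mul1g //.
by apply/ffunP => j; rewrite !ffunE /= mul1g mulg1.
Qed.

Let wreath_mulV : left_inverse one inv mul.
Proof.
move=> [u k]; congr pair; rewrite /= ?mulVg //.
by apply/ffunP => j; rewrite !ffunE /= mulVg.
Qed.

HB.instance Definition _ :=
  Finite_isGroup.Build wreath wreath_mulA wreath_mul1 wreath_mulV.

Lemma wreath_mulE (u v : wreath) :
  u * v = ([ffun j => u.1 j * v.1 (j * u.2)], u.2 * v.2).
Proof. by []. Qed.

Lemma pgroup_wreath :
  prime p -> p.-group [set: gT]%SET -> p.-group [set: wreath]%SET.
Proof.
move=> p_pr; rewrite /pgroup !cardsT card_prod card_ffun card_ord.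
rewrite Zp_cast ?prime_gt1 //.
by move=> pgT; rewrite pnatM pnatX pgT pnat_id.
Qed.

(** Powers of s meet the coordinate that holds c exactly once in p steps, so the
    first coordinate of s ^+ p is c while those of smaller powers are 1. *)
Lemma wreath_cycleX (c : gT) (s : wreath) :
  prime p -> s = ([ffun k : 'Z_p => if k == p.-1 :> nat then c else 1], Zp1) ->
  (forall j, (j < p)%N -> (s ^+ j).1 1 = 1 /\ (s ^+ j).2 = Zp1 ^+ j)
  /\ (s ^+ p).1 1 = c.
Proof.
move=> p_pr sE; have p1 := prime_gt1 p_pr.
have val1X j : (j < p)%N -> (Zp1 : 'Z_p) ^+ j = j :> nat.
  move=> jp; rewrite Zp_expg /= Zp_cast //.
  by rewrite (modn_small p1) mul1n modn_small.
have sX j : (j < p)%N -> (s ^+ j).1 1 = 1 /\ (s ^+ j).2 = Zp1 ^+ j.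
  elim: j => [|j IH] jp; first by rewrite expg0 /= ffunE.
  have [IH1 IH2] := IH (ltnW jp).
  rewrite expgSr wreath_mulE /= ffunE IH1 IH2 sE /= !mul1g -expgSr; split=> //.
  rewrite ffunE val1X ?(ltnW jp) // ifF //.
  by apply/eqP => jE; rewrite jE prednK ?ltnn // prime_gt0 in jp.
split=> //; have pP : p = p.-1.+1 by rewrite prednK // prime_gt0.
have [|s1 s2] := sX p.-1; first by rewrite -pP.
rewrite [in s ^+ p]pP expgSr wreath_mulE /= ffunE s1 s2 !mul1g sE /= ffunE.
by rewrite val1X ?eqxx // -pP.
Qed.

End Wreath.

Section Schreier.
Variables (p : nat) (G : topGroupType) (I : finType) (i0 : I).
Variables (W : set G) (x : I -> G) (phi : G -> 'Z_p).
Hypotheses (p_pr : prime p) (pG : profinite G) (fx : free_basis p W x).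
Hypotheses (fh : finite_hom W phi) (phi0 : phi (x i0) = Zp1).
Hypothesis phi1 : forall i, i != i0 -> phi (x i) = 1.

Let M : set G := W `&` phi @^-1` [set 1].
Let t : G := x i0.
Let J : finType := option ({i : I | i != i0} * 'Z_p)%type.

(** The Schreier generators t^p and t^j x_i t^-j of the kernel of phi, for the
    transversal 1, t, ..., t^(p-1). *)
Definition schreier_basis (o : J) : G :=
  if o is Some (i, j) then x (val i) ^ (t ^- j) else t ^+ p.

Let p1 : (1 < p)%N := prime_gt1 p_pr.
Let oW : open_subgroup W := basis_open fx.
Let sW : subgroup W := oW.2.
Let Wt : W t := basis_in fx i0.
Let WX n : W (t ^+ n) := subgroupX sW n Wt.
Let WXN n : W (t ^- n).
Proof. by case: sW => _ _; apply. Qed.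

Let oM : open_subgroup M := finite_hom_ker oW fh.
Let sM : subgroup M := oM.2.

Lemma kernel_conj a b : W b -> M a -> M (a ^ b).
Proof.
move=> Wb [Wa /= pa]; have [_ WM WV] := sW; have pM := fh.1.
split; first exact: subgroupJ.
rewrite /= conjgE !pM ?pa ?mul1g -?pM ?mulVg ?(hom_on1 sW pM) //; try exact: WV.
by exact: WM.
Qed.

Lemma kernel_X n : M (t ^+ n) <-> (p %| n)%N.
Proof.
have pM := fh.1; split=> [[_ /=]|pn].
  rewrite (hom_onX sW _ pM) // phi0 => /eqP; rewrite -order_dvdn.
  by have -> : #[Zp1 : 'Z_p] = p by rewrite order_Zp1; exact: Zp_cast.
split=> //=; rewrite (hom_onX sW _ pM) // phi0; apply/eqP; rewrite -order_dvdn.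
by have -> : #[Zp1 : 'Z_p] = p by rewrite order_Zp1; exact: Zp_cast.
Qed.

Lemma schreier_basis_in o : M (schreier_basis o).
Proof.
case: o => [[[i ni] j]|]; last exact/kernel_X.
by apply: kernel_conj => //; split; [exact: (basis_in fx)|exact: phi1].
Qed.

(** An open subgroup U that contains the Schreier generators contains the
    subgroup S of the elements of M whose conjugates by all t^-k lie in U. It
    is open, normalized by t and contains t^p and each x_i other than t, so
    the products of an element of S and a power of t form a subgroup K that
    contains the basis x, and is W. Then an element of M is the product of an
    element of S and a power of t^p. *)
Lemma schreier_basis_gen : topgen M schreier_basis.
Proof.
move=> U oU Uz; have [_ [U1 UM UV]] := oU.
have Up : U (t ^+ p) by exact: (Uz None).
have UpN : U (t ^- p) by exact: UV.
have Uxn i n : i != i0 -> U (x i ^ (t ^- n)).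
  move=> ni; rewrite (divn_eq n p) mulnC expgD expgM invMg conjgM.
  have UX := subgroupX oU.2 (n %/ p) Up.
  apply: subgroupJ; [exact: oU.2| |exact: UV].
  have np : ((n %% p)%N < (Zp_trunc p).+2)%N.
    by rewrite Zp_cast // ltn_mod prime_gt0.
  exact: (Uz (Some (exist _ i ni, Ordinal np))).
pose S := [set h | M h /\ forall k, U (h ^ (t ^- k))].
have [M1 MM MV] := sM; have [W1 WM WV] := sW.
have sS : subgroup S.
  split; first by split=> // k; rewrite conj1g.
  - by move=> a b [Ma Ua] [Mb Ub]; split=> [|k];
      [exact: MM|rewrite conjMg; exact: UM].
  - by move=> a [Ma Ua]; split=> [|k]; [exact: MV|rewrite conjVg; exact: UV].
have oS : open_subgroup S.
  have [oUM [UM1 _ _]] := open_subgroupI oU oM.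
  have [N [oN [[N1 _ _] NJ] NUM]] := open_normal_subgroup_basis pG oUM UM1.
  apply: (open_subgroup_sup sS oN N1) => a Na; split; first by case: (NUM _ Na).
  by move=> k; have [] := NUM _ (NJ a (t ^- k) Na).
have [S1 SM SV] := sS.
have Sp : S (t ^+ p).
  split=> [|k]; first exact/kernel_X.
  rewrite (_ : _ ^ _ = t ^+ p) //; apply/conjg_fixP/commgP.
  by apply: commuteV; apply: commuteX2.
have SJV a : S a -> S (a ^ t^-1).
  move=> [Ma Ua]; split=> [|k]; first by apply: kernel_conj => //; exact: WV.
  by rewrite -conjgM -invMg -expgSr.
have SJ a : S a -> S (a ^ t).
  move=> [Ma Ua]; split=> [|[|k]]; first exact: kernel_conj.
    rewrite expg0 invg1 conjg1.
    have -> : a ^ t = (a ^ (t ^- p.-1)) ^ (t ^+ p).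
      by rewrite -conjgM -{2}(prednK (prime_gt0 p_pr)) expgSr mulKg.
    exact: (subgroupJ oU.2).
  by rewrite -conjgM expgSr invMg mulVKg.
have SJX a k : S a -> S (a ^ (t ^+ k)).
  by move=> Sa; elim: k => [|k IH]; rewrite ?conjg1 // expgSr conjgM; exact: SJ.
have SJXV a k : S a -> S (a ^ (t ^- k)).
  move=> Sa; elim: k => [|k IH]; rewrite ?invg1 ?conjg1 //.
  by rewrite expgS invMg conjgM; exact: SJV.
pose K := [set w | exists k h, S h /\ w = h * t ^+ k].
have sK : subgroup K.
  split; first by exists 0%N, 1; rewrite mulg1.
  - move=> _ _ [k [a [Sa ->]]] [l [b [Sb ->]]].
    exists (k + l)%N, (a * b ^ (t ^- k)); split; first exact: SM (SJXV _ _ _).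
    by rewrite conjgE invgK expgD !mulgA mulgVK.
  - move=> _ [k [a [Sa ->]]].
    exists (p * k - k)%N, ((a^-1) ^ (t ^+ k) * (t ^+ (p * k))^-1); split.
      by apply: SM; [exact/SJX/SV|apply: SV; rewrite expgM; exact: subgroupX].
    (* the exponents are natural numbers: t ^- k is written with the power
       p * k - k and the element t ^+ (p * k) of S *)
    have -> : t ^+ (p * k) = t ^+ (p * k - k) * t ^+ k.
      by rewrite -expgD subnK // leq_pmull // prime_gt0.
    by rewrite !invMg conjgE !mulgA mulgK mulgVK.
have SK : S `<=` K by move=> a Sa; exists 0%N, a; rewrite mulg1.
have WK : W `<=` K.
  apply: (basis_gen fx); first exact: open_subgroup_sup sK oS.1 S1 SK.
  move=> i; have [->|ni] := eqVneq i i0.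
    by exists 1%N, 1; rewrite mul1g expg1.
  apply: SK; split; last by move=> k; exact: Uxn.
  by split; [exact: (basis_in fx)|exact: phi1].
move=> a Ma; have [k [h [Sh ah]]] := WK a Ma.1.
have Mk : M (t ^+ k).
  have -> : t ^+ k = h^-1 * a by rewrite ah mulKg.
  by apply: MM => //; apply: MV; case: Sh.
have Sk : S (t ^+ k).
  by have /kernel_X/dvdnP[l ->] := Mk; rewrite mulnC expgM; exact: subgroupX.
have [_ /(_ 0%N)] : S a by rewrite ah; exact: SM.
by rewrite expg0 invg1 conjg1.
Qed.

(** A map y from the Schreier generators to a finite p-group gT is extended by
    inducing: W maps to the wreath product of gT by Z/p, where t goes to the
    cyclic shift s twisted by y (t^p) and x_i to the family of the
    y (t^j x_i t^-j). The elements of M have trivial shift, so the first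
    coordinate is a homomorphism on M. *)
Lemma schreier_basis_free : free_basis p M schreier_basis.
Proof.
split; [exact: oM|exact: schreier_basis_in|exact: schreier_basis_gen|].
move=> gT pgT y.
pose s : wreath p gT :=
  ([ffun k : 'Z_p => if k == p.-1 :> nat then y None else 1], Zp1).
have [sX sp] := wreath_cycleX p_pr (erefl s).
pose yW i : wreath p gT := if insub i is Some i'
  then ([ffun j => y (Some (i', j))], 1) else s.
have [th [thh thx]] := basis_ext fx (pgroup_wreath p_pr pgT) yW.
have thM := thh.1.
have th2 w : W w -> (th w).2 = phi w.
  have sndh : finite_hom W ((snd : wreath p gT -> 'Z_p) \o th).
    exact: finite_hom_comp oW thh _.
  move=> Ww.
  apply: (finite_hom_ext oW (basis_gen fx) (basis_in fx) sndh fh) => // i.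
  rewrite /= thx /yW; case: insubP => [i' ni _|]; first by rewrite phi1.
  by rewrite negbK => /eqP ->; rewrite phi0.
have tht : th t = s by rewrite thx /yW insubF // eqxx.
have thX n : th (t ^+ n) = s ^+ n by rewrite (hom_onX sW _ thM) // tht.
pose f a := (th a).1 1.
have fM : hom_on M f.
  move=> a b [Wa /= pa] [Wb _]; rewrite /f thM // wreath_mulE /= ffunE th2 //.
  by rewrite pa mulg1.
exists f; split.
- split=> //.
  have [oK [K1 _ _]] := open_subgroupI oM (finite_hom_ker oW thh).
  apply: (open_subgroup_sup _ oK K1 _).1.
    by apply: hom_on_preimage => //; exact: subgroup1.
  by move=> a [Ma [_ /= tha]]; split=> //=; rewrite /f tha /= ffunE.
- case=> [[[i ni] j]|]; last by rewrite /f thX.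
  have Wx : W (x i) := basis_in fx i.
  have Mz := schreier_basis_in (Some (exist _ i ni, j)).
  have : schreier_basis (Some (exist _ i ni, j)) * t ^+ j = t ^+ j * x i.
    by rewrite /= conjgE invgK !mulgA mulgVK.
  move: (schreier_basis _) Mz => z [Wz /= pz] /(congr1 (fun g => (th g).1 1)) /=.
  have jp : (j < p)%N by rewrite -{2}(Zp_cast p1).
  have [s1 s2] := sX j jp.
  rewrite (thM _ _ Wz (WX j)) (thM _ _ (WX j) Wx) !wreath_mulE /= !ffunE.
  rewrite thX s1 s2 th2 // pz mulg1 s1 mul1g mulg1 => fz.
  by rewrite /f fz thx /yW insubT /= ffunE mul1g Zp1_expgz.
Qed.

End Schreier.

(** * A free pro-p group is free on a basis *)

Lemma card_eq_finset (T : finType) (A : {set T}) : ([set` A] #= `I_#|A|)%card.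
Proof.
rewrite (card_eqr card_II).
have -> : [set` A] = [set (enum_val i : T) | i in [set: 'I_#|A|]].
  apply/seteqP; split=> [a Aa|_ [i _ <-]]; last exact: enum_valP.
  by exists (enum_rank_in Aa a); rewrite // enum_rankK_in.
by apply: inj_card_eq => i j _ _; exact: enum_val_inj.
Qed.

Section DiscreteGroup.
Variable gT : finGroupType.

Definition discrete_group : Type := gT.
HB.instance Definition _ := Group.copy discrete_group gT.
HB.instance Definition _ := Finite.copy discrete_group gT.
HB.instance Definition _ :=
  DiscreteTopology.copy discrete_group (discrete_topology gT).

Lemma discrete_group_mul_continuous :
  continuous (fun x : discrete_group * discrete_group => x.1 * x.2).
Proof.
move=> [a b] A /nbhs_singleton Aab.
exists ([set a], [set b]); first by split; exact: discrete_set1.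
by case=> c d [/= -> ->].
Qed.

Lemma discrete_group_inv_continuous :
  continuous (fun x : discrete_group => x^-1).
Proof.
move=> a A /nbhs_singleton Aa.
by apply: (filterS _ (discrete_set1 a)) => _ ->.
Qed.

HB.instance Definition _ :=
  isTopologicalGroup.Build discrete_group
    discrete_group_mul_continuous discrete_group_inv_continuous.

Lemma pro_p_discrete_group (p : nat) :
  p.-group [set: gT]%SET -> pro_p p discrete_group.
Proof.
move=> pgT; split; first split.
- by apply: finite_compact; exact: finite_finset.
- exact: discrete_hausdorff.
- by apply: zero_dimension_totally_disconnected; exact: discrete_zero_dimension.
move=> N _ [[N1 NM NV] NJ].
pose A : {set gT} := [set x | `[< N x >]]%SET.
have AP x : reflect (N x) (x \in A) by rewrite inE; exact: asboolP.
have gA : group_set A.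
  apply/group_setP; split; first exact/AP.
  by move=> a b /AP Na /AP Nb; apply/AP; exact: NM.
have /p_natP[k indexE] : p.-nat #|[set: gT]%G : Group gA|.
  by apply: pnat_dvd pgT; exact: dvdn_indexg.
exists k; rewrite -indexE -card_lcosets.
have -> : left_cosets N = [set [set` B] | B in [set` lcosets A [set: gT]%SET]].
  have cosetE (a : gT) :
      [set` a *: A] = [set (a : discrete_group) * n | n in N].
    apply/seteqP; split=> b /=; first by case/lcosetP=> n /AP Nn ->; exists n.
    by case=> n /AP An <-; apply/lcosetP; exists n.
  apply/seteqP; split=> [_ [a _ <-]|_ [_ /lcosetsP[a _ ->] <-]].
    by exists (a *: A); [apply/lcosetsP; exists a|exact: cosetE].
  by exists a; rewrite // cosetE.
apply: card_eq_trans (card_eq_finset _).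
apply: inj_card_eq => B C _ _ BC; apply/finset.setP => b.
have := congr1 (fun X : set gT => X b) BC => /= BCb.
by apply/idP/idP; rewrite ?BCb // -BCb.
Qed.

End DiscreteGroup.

Section FreeProP.
Variables (p d : nat) (F : topGroupType).
Hypotheses (p_pr : prime p).

Lemma finite_hom_continuous (gT : finGroupType) (f : F -> discrete_group gT) :
  finite_hom [set: F] f -> continuous f.
Proof.
move=> [fM fo] a A /nbhs_singleton Aa.
have nK : nbhs a ((fun b => a^-1 * b) @^-1` (f @^-1` [set 1])).
  apply: (@mull_continuous F a^-1 a); rewrite mulVg; apply: open_nbhs_nbhs.
  rewrite setTI in fo; split=> //=.
  by apply: (mulgI (f 1)); rewrite -fM // !mulg1.
apply: (filterS _ nK) => b /= fb; suff -> : f b = f a by [].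
by rewrite -(mulVKg a b) fM // fb mulg1.
Qed.

Lemma continuous_finite_hom (gT : finGroupType) (f : F -> discrete_group gT) :
  continuous f -> {morph f : a b / a * b} -> finite_hom [set: F] f.
Proof.
move=> fc fM; split; first by move=> a b _ _; exact: fM.
rewrite setTI; apply: (open_comp _ (discrete_open _)) => a _; exact: fc.
Qed.

(** Generation comes from uniqueness in the universal property: if an open
    subgroup U contained x but was proper, a character to Z/p trivial on U
    would differ from the trivial one while agreeing with it on x. *)
Lemma free_pro_p_basis : free_pro_p p d F ->
  exists x : 'I_d -> F, free_basis p [set: F] x.
Proof.
move=> [pF [x ux]]; exists x; split=> //; first exact: open_subgroupT.
- move=> U oU Ux; apply: contrapT => nU.
  have [gT [q [pgT qM oN NU]]] := finite_p_quotient_below p_pr pF oU.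
  have [||M [[phi [fh [t _ pt] ME]] UM _]] :=
      normal_index_p_above (W := [set: F]) p_pr pgT qM oN NU oU
        (open_subgroupT F).
  - by [].
  - by move=> UT; apply: nU; rewrite UT.
  have [f [_ funi]] := ux _ (pro_p_discrete_group (pgroup_Zp p_pr)) (fun=> 1).
  have e1 : f = fun=> 1.
    by apply: funi; split=> // [|a b]; [exact: cst_continuous|rewrite mulg1].
  have e2 : f = phi.
    apply: funi; split.
    - exact: (@finite_hom_continuous _ phi).
    - by move=> a b; exact: fh.1.
    - by move=> i; have := UM _ (Ux i); rewrite ME => -[].
  by apply: (@Zp1_neq1 p); rewrite -pt -e2 e1.
- move=> gT pgT y.
  have [f [[fc fM fy] _]] := ux _ (pro_p_discrete_group pgT) y.
  by exists f; split=> //; exact: (continuous_finite_hom fc fM).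
Qed.

End FreeProP.

(** * Homomorphisms into the profinite group *)

Section ProfiniteTarget.
Variables (p : nat) (G : topGroupType).
Hypotheses (p_pr : prime p) (pG : pro_p p G).

Lemma finite_quotients_separate (a b : G) :
  (forall (gT : finGroupType) (q : G -> gT), p.-group [set: gT]%SET ->
     {morph q : u v / u * v} -> open (q @^-1` [set 1]) -> q a = q b) -> a = b.
Proof.
move=> qab; apply: contrapT => ab; have [_ hG _] := pG.1.
have oab : open (~` [set a^-1 * b]).
  apply: closed_openC; apply: accessible_closed_set1.
  exact: hausdorff_accessible.
have ab1 : (~` [set a^-1 * b]) 1.
  by move=> /= e; apply: ab; apply: (mulgI a^-1); rewrite mulVg.
have [N [oN nN Nab]] := open_normal_subgroup_basis pG.1 oab ab1.
have [gT [q [pgT qM qN]]] := finite_p_quotient p_pr pG oN nN.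
have q1 := morph_one qM.
apply: (Nab (a^-1 * b)) => //; apply/qN; rewrite qM -(qab _ q) -?qM ?mulVg //.
by rewrite (_ : _ @^-1` _ = N) //; apply/seteqP; split=> u /qN.
Qed.

(** Continuity on W, for a homomorphism f defined on the open subgroup W. *)
Definition cont_on (W : set G) (f : G -> G) : Prop :=
  forall V, open_subgroup V -> open (W `&` f @^-1` V).

Lemma cont_on_within (W : set G) (f : G -> G) :
  open_subgroup W -> hom_on W f -> cont_on W f -> {within W, continuous f}.
Proof.
move=> [oW sW] fM fc; rewrite (continuous_open_subspace _ oW).
move=> a /set_mem Wa A nA.
have : nbhs (1 : G) ((fun v => f a * v) @^-1` A).
  by apply: (@mull_continuous G (f a)); rewrite mulg1.
rewrite nbhsE => -[B [oB B1] BA].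
have [N [oN nN NB]] := open_normal_subgroup_basis pG.1 oB B1.
have nK : nbhs a ((fun b => a^-1 * b) @^-1` (W `&` f @^-1` N)).
  apply: (@mull_continuous G a^-1 a); rewrite mulVg; apply: open_nbhs_nbhs.
  split; first by apply: fc; split=> //; case: nN.
  by split=> /=; [case: sW|rewrite (hom_on1 sW fM); case: nN => -[]].
apply: (filterS _ nK) => b /= [Wab Nfab].
by rewrite -(mulVKg a b) fM //; apply/BA/NB.
Qed.

Lemma hom_on_morph_open (gT : finGroupType) (W : set G) (f : G -> G)
    (q : G -> gT) :
  open_subgroup W -> hom_on W f -> cont_on W f ->
  {morph q : u v / u * v} -> open (q @^-1` [set 1]) -> finite_hom W (q \o f).
Proof.
move=> oW fM fc qM oN; split; first by move=> a b Wa Wb /=; rewrite fM // qM.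
apply: (fc (q @^-1` [set 1])); split=> //.
have sT : subgroup [set: G] by split.
have := hom_on_preimage sT (fun a b _ _ => qM a b) (subgroup1 gT).
by rewrite setTI.
Qed.

Section Extension.
Variables (I : finType) (W : set G) (x : I -> G).
Hypothesis fx : free_basis p W x.

Let oW := basis_open fx.
Let sW : subgroup W := oW.2.

Lemma cont_hom_ext (f g : G -> G) :
  hom_on W f -> cont_on W f -> hom_on W g -> cont_on W g ->
  (forall i, f (x i) = g (x i)) -> forall a, W a -> f a = g a.
Proof.
move=> fM fc gM gc fg a Wa; apply: finite_quotients_separate => gT q _ qM oN.
apply: (finite_hom_ext oW (basis_gen fx) (basis_in fx)
  (hom_on_morph_open oW fM fc qM oN) (hom_on_morph_open oW gM gc qM oN)) => //.
by move=> i /=; rewrite fg.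
Qed.

Lemma cont_hom_into (f : G -> G) (V : set G) :
  hom_on W f -> cont_on W f -> open_subgroup V -> (forall i, V (f (x i))) ->
  forall a, W a -> V (f a).
Proof.
move=> fM fc oV Vf a Wa; suff: (W `&` f @^-1` V) a by case.
apply: (basis_gen fx) => //; last by move=> i; split; [exact: (basis_in fx)|].
by split; [exact: fc|apply: hom_on_preimage => //; exact: oV.2].
Qed.

Variable y : I -> G.

(** A finite quotient q of G, together with the homomorphism f that an extension
    of x i |-> y i to W must induce in it. *)
Definition layer (gT : finGroupType) (q f : G -> gT) : Prop :=
  [/\ p.-group [set: gT]%SET, finite_hom [set: G] q, finite_hom W f
    & forall i, f (x i) = q (y i)].

Lemma layer_lift (gT : finGroupType) (q f : G -> gT) u :
  layer q f -> W u -> exists v, q v = f u.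
Proof.
move=> [_ [qM oq] fh fq] Wu; have sT : subgroup [set: G] by split.
have q1 := hom_on1 sT qM.
suff: (W `&` [set u | exists v, q v = f u]) u by case.
have [_ WM WV] := sW; have fM := fh.1.
have [oK [K1 _ _]] := finite_hom_ker oW fh.
apply: (basis_gen fx) => //; last first.
  by move=> i; split; [exact: (basis_in fx)|exists (y i)].
apply: (open_subgroup_sup _ oK K1); last first.
  by move=> a [Wa /= fa]; split=> //=; exists 1; rewrite q1.
split; first by split; [case: sW|exists 1; rewrite q1 (hom_on1 sW fM)].
- move=> a b [Wa [v va]] [Wb [w wb]]; split; first exact: WM.
  by exists (v * w); rewrite qM // fM // va wb.
- move=> a [Wa [v va]]; split; first exact: WV.
  by exists v^-1; rewrite (hom_onV sT qM) // (hom_onV sW fM) // va.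
Qed.

Lemma layer_pair (gT hT : finGroupType) (q f : G -> gT) (q' f' : G -> hT) :
  layer q f -> layer q' f' ->
  layer (fun a => (q a, q' a) : gT * hT) (fun a => (f a, f' a) : gT * hT).
Proof.
move=> [pgT [qM oq] [fM of_] fq] [phT [qM' oq'] [fM' of'] fq'].
have pairM V (g : G -> gT) (g' : G -> hT) : finite_hom V g -> finite_hom V g' ->
    finite_hom V (fun a => (g a, g' a) : gT * hT).
  move=> [gM og] [gM' og']; split.
    by move=> a b Va Vb; rewrite gM // gM'.
  rewrite (_ : _ `&` _ = (V `&` g @^-1` [set 1]) `&` (V `&` g' @^-1` [set 1])).
    exact: openI.
  apply/seteqP; split=> a /=; first by move=> [Va [-> ->]].
  by move=> [[Va ->] [_ ->]].
split; [|exact: pairM|exact: pairM|by move=> i; rewrite fq fq'].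
by move: pgT phT; rewrite /pgroup !cardsT card_prod pnatM => -> ->.
Qed.

(** The graph of the extension of x i |-> y i, as seen by all finite quotients. *)
Definition lift_rel (u v : G) : Prop :=
  forall (gT : finGroupType) (q f : G -> gT), layer q f -> q v = f u.

Lemma layer_exists (gT : finGroupType) (q : G -> gT) :
  p.-group [set: gT]%SET -> {morph q : a b / a * b} -> open (q @^-1` [set 1]) ->
  exists f, layer q f.
Proof.
move=> pgT qM oq; have [f [fh fy]] := basis_ext fx pgT (q \o y).
by exists f; split=> //; split; [move=> a b _ _; exact: qM|rewrite setTI].
Qed.

(** The conditions q v = f u are closed, satisfiable one by one, and stable
    under conjunction because two layers combine into one; compactness gives a
    common solution v. *)
Lemma lift_rel_exists u : W u -> exists v, lift_rel u v.
Proof.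
move=> Wu; have [cG _ _] := pG.1.
pose FS : set_system G := [set B | exists (gT : finGroupType) (q f : G -> gT),
  layer q f /\ [set v | q v = f u] `<=` B].
(* The sets of FS are not indexed by the layers: a type of finite groups is
   too large to index a filter. *)
have FF : Filter FS.
  split.
  - have [|||f fl] := @layer_exists 'Z_p (fun=> 1).
    + exact: pgroup_Zp.
    + by move=> a b; rewrite mulg1.
    + by rewrite (_ : _ @^-1` _ = setT); [exact: openT|apply/seteqP; split].
    by exists 'Z_p, (fun=> 1), f.
  - move=> A B [gT [q [f [l CA]]]] [hT [q' [f' [l' CB]]]].
    exists (gT * hT)%type, (fun a => (q a, q' a)), (fun a => (f a, f' a)).
    split; first exact: layer_pair.
    by move=> v [/CA Av /CB Bv].
  - move=> A B AB [gT [q [f [l CA]]]]; exists gT, q, f; split=> //.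
    exact: subset_trans AB.
have PF : ProperFilter FS.
  split=> // -[gT [q [f [l C0]]]].
  by have [v /C0] := layer_lift l Wu.
have [v [_ vcl]] := cG FS PF filterT.
exists v => gT q f l; have [_ [qM oq] _ _] := l.
have nK : nbhs v ((fun b => v^-1 * b) @^-1` (q @^-1` [set 1])).
  apply: (@mull_continuous G v^-1 v); rewrite mulVg; apply: open_nbhs_nbhs.
  rewrite setTI in oq; split=> //=.
  by apply: (mulgI (q 1)); rewrite -qM // !mulg1.
have CC : FS [set w | q w = f u] by exists gT, q, f; split.
have [w [/= <- qvw]] := vcl _ _ CC nK.
by rewrite -(mulVKg v w) qM // qvw mulg1.
Qed.

Lemma lift_rel_unique u v w : lift_rel u v -> lift_rel u w -> v = w.
Proof.
move=> uv uw; apply: finite_quotients_separate => gT q pgT qM oq.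
by have [f l] := layer_exists pgT qM oq; rewrite (uv _ _ _ l) (uw _ _ _ l).
Qed.

Lemma basis_ext_profinite : exists f : G -> G,
  [/\ hom_on W f, cont_on W f & forall i, f (x i) = y i].
Proof.
pose f u := xget 1 [set v | lift_rel u v].
have fP u : W u -> lift_rel u (f u).
  by move=> /lift_rel_exists[v uv]; exact: (xgetPex 1 (ex_intro _ v uv)).
have fM : hom_on W f.
  move=> a b Wa Wb; have [_ WM _] := sW.
  apply: (lift_rel_unique (fP _ (WM _ _ Wa Wb))) => gT q g l.
  have [_ [qM _] [gM _] _] := l.
  by rewrite qM // gM // (fP _ Wa _ _ _ l) (fP _ Wb _ _ _ l).
exists f; split=> //.
- move=> V oV.
  have [gT [q [pgT qM oq qV]]] := finite_p_quotient_below p_pr pG oV.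
  have [g l] := layer_exists pgT qM oq; have [_ _ gh _] := l.
  have [oK [K1 _ _]] := finite_hom_ker oW gh.
  apply: (open_subgroup_sup _ oK K1 _).1.
    by apply: hom_on_preimage => //; exact: oV.2.
  by move=> a [Wa /= ga]; split=> //; apply: qV; rewrite /= (fP _ Wa _ _ _ l).
- move=> i; apply: (lift_rel_unique (fP _ (basis_in fx i))).
  move=> gT q g [_ _ _ gq].
  by rewrite gq.
Qed.

End Extension.

(** The extensions of x i |-> y i and of y i |-> x i are inverse to each other
    since their composites fix the bases. *)
Lemma basis_iso (I : finType) (W V : set G) (x y : I -> G) :
  free_basis p W x -> free_basis p V y ->
  exists f : virtual_iso G,
    [/\ vdom f = W, vcod f = V & forall i, vfun f (x i) = y i].
Proof.
move=> fx fy; have [f [fM fc fxy]] := basis_ext_profinite fx y.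
have [g [gM gc gyx]] := basis_ext_profinite fy x.
have oW := basis_open fx; have oV := basis_open fy.
have fV : forall a, W a -> V (f a).
  by apply: (cont_hom_into fx) => // i; rewrite fxy; exact: (basis_in fy).
have gW : forall a, V a -> W (g a).
  by apply: (cont_hom_into fy) => // i; rewrite gyx; exact: (basis_in fx).
have comp_cont (A B : set G) (h k : G -> G) :
    open_subgroup A -> open_subgroup B -> hom_on B k ->
    cont_on A h -> cont_on B k -> (forall a, A a -> B (h a)) ->
    cont_on A (k \o h).
  move=> oA oB kM hc kc hB U oU.
  rewrite (_ : _ `&` _ = A `&` h @^-1` (B `&` k @^-1` U)).
    apply: hc; split; first exact: kc.
    by apply: hom_on_preimage => //; [exact: oB.2|exact: oU.2].
  by apply/seteqP; split=> a [Aa /=]; [split=> //; split=> //; exact: hB|case].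
have id_cont (A : set G) : open_subgroup A -> cont_on A id.
  by move=> [oA _] U [oU _]; exact: openI.
have fK a : W a -> g (f a) = a.
  apply: (cont_hom_ext fx (f := g \o f) (g := id)) => //.
  - by move=> b c Wb Wc /=; rewrite fM // gM //; exact: fV.
  - exact: (comp_cont _ _ _ _ oW oV).
  - exact: id_cont.
  - by move=> i /=; rewrite fxy.
have gK a : V a -> f (g a) = a.
  apply: (cont_hom_ext fy (f := f \o g) (g := id)) => //.
  - by move=> b c Vb Vc /=; rewrite gM // fM //; exact: gW.
  - exact: (comp_cont _ _ _ _ oV oW).
  - exact: id_cont.
  - by move=> i /=; rewrite gyx.
by exists (VirtualIso oW oV fV gW fK gK fM (cont_on_within oW fM fc)
  (cont_on_within oV gM gc)).
Qed.

End ProfiniteTarget.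

(** * Virtual isomorphisms *)

Section VirtualIsos.
Variables (p : nat) (G : topGroupType).
Hypotheses (p_pr : prime p).

Lemma finite_hom_pullback (f : virtual_iso G) (H : groupType) (h : G -> H) :
  finite_hom (vdom f) h -> finite_hom (vcod f) (h \o vinv f).
Proof.
move=> hh; split.
  move=> a b fa fb /=; rewrite vinvM // hh.1 //; exact: vinv_dom.
have [oK _] :=
  open_subgroup_preimage (virtual_inv f) (finite_hom_ker (vdom_open f) hh).
rewrite (_ : _ `&` _ = vcod f `&` vinv f @^-1` (vdom f `&` h @^-1` [set 1])) //.
apply/seteqP; split=> a [fa /=]; last by case.
by split=> //; split=> //; exact: vinv_dom.
Qed.

Lemma normal_index_p_image (f : virtual_iso G) (M : set G) :
  normal_index_p p (vdom f) M ->
  normal_index_p p (vcod f) (vcod f `&` vinv f @^-1` M).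
Proof.
move=> [phi [fh [t ft pt] ->]]; exists (phi \o vinv f); split.
- exact: finite_hom_pullback.
- by exists (vfun f t); [exact: vfun_cod|rewrite /= vfunK].
- apply/seteqP; split=> a [fa /=]; first by case.
  by split=> //; split=> //; exact: vinv_dom.
Qed.

(** A free group of rank n has p ^ n homomorphisms to Z/p, and pulling back
    along the inverse of f is injective on them. *)
Lemma basis_card_le (f : virtual_iso G) (I J : finType) (x : I -> G)
    (y : J -> G) :
  free_basis p (vdom f) x -> free_basis p (vcod f) y -> (#|I| <= #|J|)%N.
Proof.
move=> fx fy.
have /choice[phi phiP] : forall a : {ffun I -> 'Z_p}, exists phi : G -> 'Z_p,
    finite_hom (vdom f) phi /\ forall i, phi (x i) = a i.
  by move=> a; exact: (basis_ext fx (pgroup_Zp p_pr)).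
pose r (a : {ffun I -> 'Z_p}) : {ffun J -> 'Z_p} :=
  [ffun j => phi a (vinv f (y j))].
have r_inj : injective r.
  move=> a b rab; apply/ffunP => i.
  rewrite -(phiP a).2 -(phiP b).2 -(vfunK (basis_in fx i)).
  apply: (finite_hom_ext (basis_open fy) (basis_gen fy) (basis_in fy)
    (finite_hom_pullback (phiP a).1) (finite_hom_pullback (phiP b).1)).
    by move=> j; have /ffunP/(_ j) := rab; rewrite !ffunE.
  exact: vfun_cod (basis_in fx i).
have := leq_card r r_inj.
by rewrite !card_ffun card_ord Zp_cast ?prime_gt1 // leq_exp2l // prime_gt1.
Qed.

(** Composing with this identity restricts a virtual isomorphism to W without
    changing its class in the commensurator. *)
Definition virtual_id_on (W : set G) (oW : open_subgroup W) : virtual_iso G.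
Proof.
by refine (@VirtualIso G W W id id oW oW _ _ _ _ _ _ _) => //;
  apply: continuous_subspaceT => x; exact: cvg_id.
Defined.

Lemma pi_virtual_id_on (W : set G) (oW : open_subgroup W) :
  \pi_(Comm G)%qT (virtual_id_on oW) = 1.
Proof. by apply/pi_CommP; exists W; split. Qed.

Lemma AComm_subgroup : subgroup (AComm G).
Proof.
split; first by move=> A [[A1 _ _] _].
- move=> a b Aa Ab A [sA AA]; have [_ AM _] := sA.
  by apply: AM; [exact: Aa|exact: Ab].
- by move=> a Aa A [sA AA]; have [_ _ AV] := sA; apply: AV; exact: Aa.
Qed.

Lemma AComm_aut (f : virtual_iso G) :
  vdom f = vcod f -> AComm G (\pi_(Comm G)%qT f).
Proof.
move=> ff A [_ AA]; apply: AA; exists (vdom f); first exact: vdom_open.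
by exists f.
Qed.

End VirtualIsos.

(** * Chains of subgroups of index p *)

Section Chains.
Variables (p : nat) (G : topGroupType).
Hypotheses (p_pr : prime p) (pG : pro_p p G).

Fixpoint normal_chain (k : nat) (U : set G) : Prop :=
  if k is k'.+1 then exists2 W, normal_chain k' W & normal_index_p p W U
  else U = [set: G].

Lemma normal_chain_open k U : normal_chain k U -> open_subgroup U.
Proof.
elim: k U => [_ ->|k IH U [W cW WU]]; first exact: open_subgroupT.
by apply: normal_index_p_open WU; exact: IH.
Qed.

Lemma normal_chain_exists U : open_subgroup U -> exists k, normal_chain k U.
Proof.
move=> oU; have [gT [q [pgT qM oN NU]]] := finite_p_quotient_below p_pr pG oU.
suff H n k W : (#|finite_image q W| <= n)%N -> normal_chain k W -> U `<=` W ->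
    exists k', normal_chain k' U.
  exact: (H _ 0%N [set: G] (leqnn _)).
elim: n k W => [|n IH] k W.
  rewrite leqn0 cards_eq0 => /eqP W0 cW _.
  have [_ [W1 _ _]] := normal_chain_open cW.
  have : q 1 \in finite_image q W by apply/finite_imageP; exists 1.
  by rewrite W0 inE.
move=> Wn cW UW; have [->|nUW] := pselect (U = W); first by exists k.
have [M [WM UM cM]] :=
  normal_index_p_above p_pr pgT qM oN NU oU (normal_chain_open cW) UW nUW.
apply: (IH k.+1 M) => //; last by exists W.
by rewrite -ltnS; exact: leq_trans cM Wn.
Qed.

(** The rank of a subgroup reached by a chain of length k in a free group of
    rank n. *)
Fixpoint schreier_rank (n k : nat) : nat :=
  if k is k'.+1 then ((schreier_rank n k').-1 * p).+1 else n.

Lemma schreier_rank_mono n :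
  (1 < n)%N -> {homo schreier_rank n : k l / (k < l)%N}.
Proof.
move=> n1; have p1 := prime_gt1 p_pr.
have r1 k : (1 < schreier_rank n k)%N.
  elim: k => [//|k IH] /=; rewrite ltnS muln_gt0 (prime_gt0 p_pr) andbT.
  by rewrite -ltnS prednK // ltnW.
apply: homo_ltn => [|k /=]; first exact: ltn_trans.
rewrite -{1}(prednK (ltnW (r1 k))) ltnS -{1}[_.-1]muln1 ltn_pmul2l //.
by rewrite -ltnS prednK // ltnW.
Qed.

Lemma normal_chain_basis (I : finType) (x : I -> G) k U :
  free_basis p [set: G] x -> (1 < #|I|)%N -> normal_chain k U ->
  exists (J : finType) (y : J -> G),
    free_basis p U y /\ #|J| = schreier_rank #|I| k.
Proof.
move=> fx I1; elim: k U => [_ ->|k IH U [W cW WU]]; first by exists I, x.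
have [J [y [fy cJ]]] := IH W cW.
have /card_gt0P[j0 _] : (0 < #|J|)%N.
  rewrite cJ; case: {+}k => [|l] //=; exact: ltnW.
have [y' [phi [fy' fh -> p0 p1]]] := adapted_basis p_pr j0 fy WU.
exists (option ({j : J | j != j0} * 'Z_p)%type), (schreier_basis y' (i0 := j0)).
split; first exact: (schreier_basis_free p_pr pG.1 fy' fh p0 p1).
rewrite card_option card_prod card_ord Zp_cast ?prime_gt1 // /= -cJ.
by rewrite card_sig cardC1.
Qed.

(** For bases y and z adapted to M and M', the automorphism y i |-> z i carries
    the character of M to that of M', since they agree on the bases. *)
Lemma normal_index_p_transitive (I : finType) (x : I -> G) (W M M' : set G) :
  free_basis p W x -> (0 < #|I|)%N ->
  normal_index_p p W M -> normal_index_p p W M' ->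
  exists f : virtual_iso G,
    [/\ vdom f = W, vcod f = W & forall a, W a -> M (vinv f a) <-> M' a].
Proof.
move=> fx /card_gt0P[i0 _] WM WM'.
have [y [phi [fy fh ME p0 p1]]] := adapted_basis p_pr i0 fx WM.
have [z [psi [fz gh ME' q0 q1]]] := adapted_basis p_pr i0 fx WM'.
have [f [fW fW' fyz]] := basis_iso p_pr pG fy fz.
exists f; split=> // a Wa.
have pfE : forall a, W a -> phi (vinv f a) = psi a.
  have ph : finite_hom W (phi \o vinv f).
    by rewrite -fW'; apply: finite_hom_pullback; rewrite fW.
  apply: (finite_hom_ext (basis_open fz) (basis_gen fz) (basis_in fz) ph gh).
  move=> i /=.
  rewrite -fyz vfunK; last by rewrite fW; exact: (basis_in fy).
  rewrite fyz; have [->|ni] := eqVneq i i0; first by rewrite p0 q0.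
  by rewrite p1 // q1.
rewrite ME ME'; split=> [[_ /= pa]|[_ /= pa]]; split=> //=.
- by rewrite -(pfE a Wa).
- by rewrite -fW; apply: vinv_dom; rewrite fW'.
- by rewrite (pfE a Wa).
Qed.

(** If U and V have index p in U' and V', an isomorphism U' -> V' given by
    induction carries U to some subgroup of index p of V', which an
    automorphism of V' moves to V. *)
Lemma normal_chain_iso (I : finType) (x : I -> G) k U V :
  free_basis p [set: G] x -> (1 < #|I|)%N ->
  normal_chain k U -> normal_chain k V ->
  exists f : virtual_iso G,
    [/\ vdom f = U, vcod f = V & AComm G (\pi_(Comm G)%qT f)].
Proof.
move=> fx I1; elim: k U V => [|k IH] U V.
  move=> -> ->; exists (virtual_id G); split=> //.
  exact: AComm_aut.
move=> cU cV; have oU := normal_chain_open cU.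
case: cU cV => [U' cU' UU] [V' cV' VV].
have [f [fU fV Af]] := IH _ _ cU' cV'.
have [J [y [fy cJ]]] := normal_chain_basis fx I1 cV'.
have J0 : (0 < #|J|)%N by rewrite cJ; case: {+}k => [|l] //=; exact: ltnW.
have VU : normal_index_p p V' (V' `&` vinv f @^-1` U).
  by rewrite -fV; apply: normal_index_p_image; rewrite fU.
have [g [gV gV' gE]] := normal_index_p_transitive fy J0 VU VV.
have sUU : U `<=` U' by case: UU => phi [_ _ ->] a [].
have sVV : V `<=` V' by case: VV => phi [_ _ ->] a [].
exists (virtual_comp (virtual_comp g f) (virtual_id_on oU)); split.
- apply/seteqP; split=> a /=; first by case.
  move=> Ua; do 2?split=> //=; rewrite ?fU ?gV; first exact: sUU.
  by rewrite -fV; apply: vfun_cod; rewrite fU; exact: sUU.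
- apply/seteqP; split=> a /=.
    move=> [[+ +] Ua]; rewrite gV' fV => Va Vga.
    by apply/gE.
  move=> Va; have V'a := sVV _ Va; have [Vga Ufga] := (gE a V'a).2 Va.
  by split=> //; split; rewrite ?gV' ?fV.
- rewrite -!mul_CommE pi_virtual_id_on mulg1.
  have [_ AM _] := AComm_subgroup G; apply: AM => //.
  by apply: AComm_aut; rewrite gV.
Qed.

(** Every finite quotient is cyclic. *)
Lemma free_rank_le1_abelian (I : finType) (x : I -> G) :
  free_basis p [set: G] x -> (#|I| <= 1)%N -> forall a b : G, commute a b.
Proof.
move=> fx I1 a b; apply: (finite_quotients_separate p_pr pG) => gT q _ qM oN.
have q1 := morph_one qM.
have [c cx] : exists c, forall i, x i = c.
  have [I0|/card_gt0P[i0 _]] := posnP #|I|.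
    by exists 1 => i; have := card0_eq I0 i; rewrite inE.
  by exists (x i0) => i; rewrite (card_le1_eqP I1 i i0).
have qc u : q u \in <[q c]>%g.
  pose U := [set u | q u \in <[q c]>%g].
  have sU : subgroup U.
    split=> [|v w|v]; rewrite /U /= ?q1 ?group1 //.
    - by rewrite qM => qv qw; rewrite groupM.
    - move=> qv; have -> : q v^-1 = (q v)^-1.
        by apply: (mulgI (q v)); rewrite -qM !mulgV.
      by rewrite groupV.
  have oU : open_subgroup U.
    by apply: (open_subgroup_sup sU oN q1) => v /= qv; rewrite /U /= qv group1.
  have := basis_gen fx oU; apply=> // i; rewrite /U /= (cx i).
  exact: cycle_id.
rewrite !qM; exact: (centsP (cycle_abelian (q c))).
Qed.

(** The rank is an isomorphism invariant and, for a group of rank at least 2,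
    strictly increases with the length of the chain. *)
Lemma normal_chain_length_eq (I : finType) (x : I -> G) k l U V
    (f : virtual_iso G) :
  free_basis p [set: G] x -> (1 < #|I|)%N ->
  normal_chain k U -> normal_chain l V ->
  vdom f = U -> vcod f = V -> k = l.
Proof.
move=> fx I1 cU cV fU fV.
have [J [y [fy cJ]]] := normal_chain_basis fx I1 cU.
have [K [z [fz cK]]] := normal_chain_basis fx I1 cV.
have JK : #|J| = #|K|.
  apply/eqP; rewrite eqn_leq; apply/andP; split.
    by apply: (basis_card_le p_pr (f := f) (x := y) (y := z)); rewrite ?fU ?fV.
  by apply: (basis_card_le p_pr (f := virtual_inv f) (x := z) (y := y));
    rewrite /= ?fU ?fV.
rewrite cJ cK in JK; case: (ltngtP k l) => // /(schreier_rank_mono I1).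
  by rewrite JK ltnn.
by rewrite JK ltnn.
Qed.

End Chains.

Theorem proposition7p7 (p d : nat) (F : topGroupType) (p_prime : prime p)
    (F_free : free_pro_p p d F)
    (F_nonabelian : ~ (forall x y : F, commute x y)) :
  AComm F = [set: Comm F]%classic.
Proof.
have [x fx] := free_pro_p_basis p_prime F_free; have [pF _] := F_free.
have d1 : (1 < #|'I_d|)%N.
  rewrite ltnNge; apply/negP => d1; apply: F_nonabelian.
  exact: (free_rank_le1_abelian p_prime pF fx d1).
apply/seteqP; split=> // c _; elim/quotW: c => f.
have [k ck] := normal_chain_exists p_prime pF (vdom_open f).
have [l cl] := normal_chain_exists p_prime pF (vcod_open f).
have kl := normal_chain_length_eq p_prime pF fx d1 ck cl erefl erefl; subst l.
have [g [gU gV Ag]] := normal_chain_iso p_prime pF fx d1 ck cl.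
have [_ AM _] := AComm_subgroup F.
rewrite -(mulVKg (\pi_(Comm F)%qT g) (\pi_(Comm F)%qT f)).
apply: AM => //.
have -> : (\pi_(Comm F)%qT g)^-1 = \pi_(Comm F)%qT (virtual_inv g).
  by rewrite (pi_inv g).
rewrite mul_CommE; apply: AComm_aut.
apply/seteqP; split=> a /=.
- move=> [fa _]; rewrite gU; split=> //=.
  by rewrite -gV; apply: vfun_cod; rewrite gU.
- rewrite gU gV => -[fa _]; split=> //; exact: vfun_cod.
Qed.
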